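(* Let $S=\{J_\sigma\}_{\sigma\in\Sigma}$ be a pointed set, with axis $J_0\ne0$, of nonzero vectors in $\mathcal N\times\mathbb R^n\times\mathcal P\subset\mathcal J^2$. Consider the normalized proper elliptic linear operators $\overline F_\sigma(J):=\langle J_\sigma,J\rangle/\langle J_\sigma,J_0\rangle$ and half-space subequations $\mathcal F_\sigma:=\{J\in\mathcal J^2:\overline F_\sigma(J)\ge0\}$, whose intersection $\mathcal F:=\bigcap_\sigma\mathcal F_\sigma$ is a convex cone subequation for which $F(J):=\inf_{\sigma\in\Sigma}\overline F_\sigma(J)$ is the canonical operator determined by $J_0$. (a) Suppose that $S\subset\mathcal M^\circ$ with $\mathcal M$ one of the monotonicity cone subequations $\mathcal M(\gamma)$, $\mathcal M(\mathcal P)$, $\mathcal M(\mathcal D)$, $\mathcal M(\gamma,\mathcal D)$, $\mathcal M(\mathcal D,\mathcal P)$ or $\mathcal M(\gamma,\mathcal D,\mathcal P)$. Then for every $c\in\mathbb R$ and every bounded domain $\Omega\subset\mathbb R^n$ one has the comparison principle $$u\le w\ \text{on}\ \partial\Omega\ \Longrightarrow\ u\le w\ \text{on}\ \Omega$$ for all $u\in\mathrm{USC}(\overline\Omega)$ and $w\in\mathrm{LSC}(\overline\Omega)$ which are respectively a viscosity subsolution and a viscosity supersolution of $F(u,Du,D^2u)=c$ on $\Omega$. (b) If, instead, $S\subset\mathcal M^\circ$ with $\mathcal M$ one of the monotonicity cone subequations $\mathcal M(R)$, $\mathcal M(\gamma,R)$, $\mathcal M(\mathcal D,R)$ or $\mathcal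 M(\gamma,\mathcal D,R)$ with $R\in(0,\infty)$ finite, then this comparison principle for $F$ holds (for every $c\in\mathbb R$) on domains $\Omega$ contained in a translate of the truncated cone $\mathcal D\cap B_R(0)$ (with $\mathcal D=\mathbb R^n$, so a ball of radius $R$, for $\mathcal M(R)$ and $\mathcal M(\gamma,R)$).
   Context: $\mathcal S(n)$ is the space of real symmetric $n\times n$ matrices, $\mathcal P=\{A\in\mathcal S(n):A\ge0\}$, $\mathcal N=(-\infty,0]$, $\mathcal J^2=\mathbb R\times\mathbb R^n\times\mathcal S(n)$ with inner product $\langle(a,b,E),(r,p,A)\rangle=ar+\langle b,p\rangle+\mathrm{tr}(EA)$. A set $S=\{J_\sigma\}_{\sigma\in\Sigma}$ of nonzero vectors is pointed with axis $J_0\neq0$ if there is $\varepsilon>0$ with $\langle J_\sigma,J_0\rangle\ge\varepsilon\|J_\sigma\|$ for all $\sigma\in\Sigma$. The polar of $\mathcal M\subset\mathcal J^2$ is $\mathcal M^\circ=\{J\in\mathcal J^2:\langle J,J'\rangle\ge0\ \forall J'\in\mathcal M\}$. A directional cone is a closed convex cone $\mathcal D\subseteq\mathbb R^n$ with vertex at the origin and nonempty interior. For $\gamma\in[0,\infty)$, $R\in(0,\infty)$ and a directional cone $\mathcal D$: $\mathcal M(\gamma)=\{(r,p,A):r\le-\gamma|p|\}$, $\mathcal M(\mathcal P)=\{(r,p,A):A\ge0\}$, $\mathcal M(\mathcal D)=\{(r,p,A):p\in\mathcal D\}$, $\mathcal M(R)=\{(r,p,A):A\ge\frac{|p|}RI\}$;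 several arguments denote intersections, e.g. $\mathcal M(\gamma,\mathcal D,R)=\mathcal M(\gamma)\cap\mathcal M(\mathcal D)\cap\mathcal M(R)$, $\mathcal M(\mathcal D,\mathcal P)=\mathcal M(\mathcal D)\cap\mathcal M(\mathcal P)$. $\mathrm{USC}$ (resp. $\mathrm{LSC}$) functions take values in $[-\infty,\infty)$ (resp. $(-\infty,\infty]$). $u$ is a viscosity subsolution of $F(u,Du,D^2u)=c$ on $\Omega$ if $F(\varphi(x_0),D\varphi(x_0),D^2\varphi(x_0))\ge c$ for every $x_0\in\Omega$ and every $\varphi$ that is $C^2$ near $x_0$ with $u\le\varphi$ near $x_0$, $u(x_0)=\varphi(x_0)$; $w$ is a viscosity supersolution if $F(\varphi(x_0),D\varphi(x_0),D^2\varphi(x_0))\le c$ for every $x_0\in\Omega$ and every $\varphi$ that is $C^2$ near $x_0$ with $w\ge\varphi$ near $x_0$, $w(x_0)=\varphi(x_0)$. (The canonical operator of a convex cone subequation $\mathcal F$ determined by $J_0\in\mathrm{Int}\,\mathcal F$ is $J\mapsto-t_J$, with $t_J$ the unique real number such that $J+t_JJ_0\in\partial\mathcal F$.) *)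

(* Defs.v *)
From HB Require Import structures.
From mathcomp Require Import all_boot all_order all_algebra.
From mathcomp Require Import all_classical all_reals all_analysis.

Set Implicit Arguments.
Unset Strict Implicit.
Unset Printing Implicit Defensive.

Import Order.TTheory GRing.Theory Num.Theory.
Import numFieldNormedType.Exports.

Local Open Scope classical_set_scope.
Local Open Scope ring_scope.

Definition bdry (T : topologicalType) (A : set T) : set T :=
  closure A `\` A°.

Section Jets.
Context {R : realType} {n : nat}.

Definition dot (p q : 'rV[R]_n) : R := \sum_(i < n) p 0 i * q 0 i.

(* The library norm on 'rV[R]_n is the sup norm; the norm |p| of the theory
   is the Euclidean one. *)
Definition enorm (p : 'rV[R]_n) : R := Num.sqrt (dot p p).

Definition psd : set 'M[R]_n :=
  [set A | A^T = A /\ forall x : 'rV[R]_n, 0 <= dot (x *m A) x].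

(* Triples ((r, p), A) with A an arbitrary square matrix; the jet space of the
   theory is the linear subspace J2 cut out by the symmetry of A, and all
   topological notions for subsets of it are taken in [subspace J2]. *)
Definition jet := (R * 'rV[R]_n * 'M[R]_n)%type.

Definition J2 : set jet := [set J | J.2^T = J.2].

Definition jinner (J K : jet) : R :=
  J.1.1 * K.1.1 + dot J.1.2 K.1.2 + \tr (J.2 *m K.2).

Definition jnorm (J : jet) : R := Num.sqrt (jinner J J).

Definition jinterior (F : set jet) : set jet := @interior (subspace J2) F.
Definition jclosure (F : set jet) : set jet := @closure (subspace J2) F.
Definition jbdry (F : set jet) : set jet := @bdry (subspace J2) F.

Definition NxRnxP : set jet := [set J | J.1.1 <= 0 /\ psd J.2].

Definition pointed_with_axis (Sigma : Type) (S : Sigma -> jet) (J0 : jet) :=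
  [/\ J2 J0, J0 != 0 &
    exists2 eps : R, 0 < eps & forall s, eps * jnorm (S s) <= jinner (S s) J0].

Definition polar (M : set jet) : set jet :=
  [set J | J2 J /\ forall K, M K -> 0 <= jinner J K].

(* Closed (by the last clause), with the positivity (P), negativity (N) and
   topological (T) properties of a subequation constraint set. *)
Definition subequation (F : set jet) : Prop :=
  [/\ F `<=` J2, F !=set0 & F <> J2] /\
  [/\ (forall r p A Q, F (r, p, A) -> psd Q -> F (r, p, A + Q)),
      (forall r s p A, F (r, p, A) -> s <= 0 -> F (r + s, p, A)) &
      F = jclosure (jinterior F)].

Definition cone_set (V : lmodType R) (C : set V) : Prop :=
  forall (t : R) x, 0 <= t -> C x -> C (t *: x).

Definition convex_cone_subequation (F : set jet) : Prop :=
  [/\ subequation F, cone_set F & convex_set F].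

Definition canonical_operator (F : set jet) (J0 : jet) (G : jet -> R) : Prop :=
  jinterior F J0 /\
  forall J, J2 J -> forall t : R, jbdry F (J + t *: J0) <-> t = - G J.

Definition Fbar (Sigma : Type) (S : Sigma -> jet) (J0 : jet)
    (s : Sigma) (J : jet) : R :=
  jinner (S s) J / jinner (S s) J0.

Definition halfspace (Sigma : Type) (S : Sigma -> jet) (J0 : jet)
    (s : Sigma) : set jet :=
  [set J | J2 J /\ 0 <= Fbar S J0 s J].

Definition Finf (Sigma : Type) (S : Sigma -> jet) (J0 : jet) (J : jet) : R :=
  inf (range (fun s => Fbar S J0 s J)).

Definition directional_cone (D : set 'rV[R]_n) : Prop :=
  [/\ closed D, cone_set D, convex_set D & D° !=set0].

Definition Mgamma (gamma : R) : set jet :=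
  [set J | J2 J /\ J.1.1 <= - gamma * enorm J.1.2].
Definition MP : set jet := [set J | psd J.2].
Definition MD (D : set 'rV[R]_n) : set jet := [set J | J2 J /\ D J.1.2].
Definition MR (rho : R) : set jet :=
  [set J | psd (J.2 - (enorm J.1.2 / rho)%:M)].

Inductive cone_bounded : set jet -> Prop :=
| Bgamma gamma of 0 <= gamma : cone_bounded (Mgamma gamma)
| BP : cone_bounded MP
| BD D of directional_cone D : cone_bounded (MD D)
| BgammaD gamma D of 0 <= gamma & directional_cone D :
    cone_bounded (Mgamma gamma `&` MD D)
| BDP D of directional_cone D : cone_bounded (MD D `&` MP)
| BgammaDP gamma D of 0 <= gamma & directional_cone D :
    cone_bounded (Mgamma gamma `&` MD D `&` MP).

(* [cone_radius M D rho]: M is a monotonicity cone with finite radius rho whose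
   truncated cone is built on D. *)
Inductive cone_radius : set jet -> set 'rV[R]_n -> R -> Prop :=
| RR rho of 0 < rho : cone_radius (MR rho) setT rho
| RgammaR gamma rho of 0 <= gamma & 0 < rho :
    cone_radius (Mgamma gamma `&` MR rho) setT rho
| RDR D rho of directional_cone D & 0 < rho :
    cone_radius (MD D `&` MR rho) D rho
| RgammaDR gamma D rho of 0 <= gamma & directional_cone D & 0 < rho :
    cone_radius (Mgamma gamma `&` MD D `&` MR rho) D rho.

Definition translated_truncated_cone (x0 : 'rV[R]_n) (D : set 'rV[R]_n)
    (rho : R) : set 'rV[R]_n :=
  [set x | D (x - x0) /\ enorm (x - x0) < rho].

Definition partial (i : 'I_n) (f : 'rV[R]_n -> R) : 'rV[R]_n -> R :=
  fun x => 'D_(delta_mx 0 i) f x.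

Definition C1_near (f : 'rV[R]_n -> R) (x : 'rV[R]_n) : Prop :=
  \forall y \near x, forall i,
    derivable f y (delta_mx 0 i) /\ {for y, continuous (partial i f)}.

Definition C2_near (f : 'rV[R]_n -> R) (x : 'rV[R]_n) : Prop :=
  C1_near f x /\ forall i, C1_near (partial i f) x.

Definition jet_of (f : 'rV[R]_n -> R) (x : 'rV[R]_n) : jet :=
  (f x, \row_i partial i f x, \matrix_(i, j) partial j (partial i f) x).

Definition domain (Om : set 'rV[R]_n) : Prop :=
  [/\ open Om, connected Om & Om !=set0].

Definition usc_on (K : set 'rV[R]_n) (u : 'rV[R]_n -> \bar R) : Prop :=
  (forall x, K x -> (u x < +oo)%E) /\
  @lower_semicontinuous (subspace K) R (fun x => - u x)%E.

Definition lsc_on (K : set 'rV[R]_n) (w : 'rV[R]_n -> \bar R) : Prop :=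
  (forall x, K x -> (-oo < w x)%E) /\
  @lower_semicontinuous (subspace K) R w.

Definition viscosity_subsolution (F : jet -> R) (c : R) (Om : set 'rV[R]_n)
    (u : 'rV[R]_n -> \bar R) : Prop :=
  forall (x0 : 'rV[R]_n) (phi : 'rV[R]_n -> R), Om x0 -> C2_near phi x0 ->
    (\forall x \near x0, (u x <= (phi x)%:E)%E) -> u x0 = (phi x0)%:E ->
    c <= F (jet_of phi x0).

Definition viscosity_supersolution (F : jet -> R) (c : R) (Om : set 'rV[R]_n)
    (w : 'rV[R]_n -> \bar R) : Prop :=
  forall (x0 : 'rV[R]_n) (phi : 'rV[R]_n -> R), Om x0 -> C2_near phi x0 ->
    (\forall x \near x0, ((phi x)%:E <= w x)%E) -> w x0 = (phi x0)%:E ->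
    F (jet_of phi x0) <= c.

Definition comparison (F : jet -> R) (c : R) (Om : set 'rV[R]_n) : Prop :=
  forall u w : 'rV[R]_n -> \bar R,
    usc_on (closure Om) u -> lsc_on (closure Om) w ->
    viscosity_subsolution F c Om u -> viscosity_supersolution F c Om w ->
    (forall x, bdry Om x -> (u x <= w x)%E) ->
    forall x, Om x -> (u x <= w x)%E.

End Jets.

Arguments jet : clear implicits.

(* Main.v *)
Require Import Defs.
From mathcomp Require Import all_boot all_order all_algebra.
From mathcomp Require Import all_classical all_reals all_analysis.
From mathcomp Require Import ring lra.
Import Order.TTheory GRing.Theory Num.Theory.
Import numFieldNormedType.Exports.
Local Open Scope classical_set_scope.
Local Open Scope ring_scope.

(** The operator [Finf] is an infimum of linear operators with constant
    coefficients.  Being concave and invariant under translations, it lets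
    averages of translates of a subsolution be subsolutions again; so a
    subsolution can be replaced by a smooth one, which then serves as a test
    function for the supersolution.  Only the subsolution is regularized: no
    doubling of variables is involved.

    The first regularization is a sup-convolution with a bounded, Lipschitz and
    semiconcave penalty ([sup_convolution], [sup_convolution_subsolution]): it
    yields a function [f] that is Lipschitz and semiconvex on the whole space,
    dominates [u] on the closure of the domain, and is still a viscosity subsolution away from the boundary.
    The second is a mollification by iterated box averages ([smooth]), whose
    derivatives are explicit difference quotients ([smooth_jets]).

    That the mollification [v] of [f] is a classical subsolution is proved one
    linear operator at a time ([mollify_subsolution]).  A positive semidefinite
    coefficient matrix is a sum of squares ([psd_decomposition]), so the operator
    generates a random walk.  The maximum principle, applied inductively to the
    steps of this walk started from a mollification of [f], shows that [f + c * t]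
    stays below the evolved function up to [o(t)] ([key_inequality]).  The test
    functions in this induction are the evolved functions plus a quadratic
    barrier, which are smooth.  The inequality is stable under averaging; for [v] in place of [f] the
    evolution can be expanded to first order in [t] ([iter_walk_le]), and dividing
    by [t] gives the pointwise inequality for [v].

    If now [u > w] somewhere, add to [v] a small multiple of
    [psi x = |x - x0|^2 - C], where [x0] is the vertex of the truncated cone.  The
    jets of [psi] on the domain are interior to the monotonicity cone
    ([approximator_margin]), so the operator, which is superadditive, is strictly
    above [c] on [v + eps * psi]; but this function touches [w] from below, up to a
    constant, at an interior point ([touching_localized],
    [comparison_of_approximator]).  The ten cones of the statement reduce to
    [elliptic_cone], the smallest one, because polarity reverses inclusions
    ([cone_radius_elliptic], [cone_bounded_elliptic]).

    For the intersection of the half-spaces, pointedness makes the normalized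
    operators uniformly Lipschitz ([Fbar_bound]), and each of them grows at unit
    speed along [J0]; hence the interior is [0 < Finf] and the boundary is
    [Finf = 0]. *)

Set Implicit Arguments.
Unset Strict Implicit.


(** * Averages of translates *)

Section Averages.
Context {R : realType} {n : nat}.
Notation V := 'rV[R]_n.
Implicit Types (f g : V -> R) (x y z : V) (L c e : R).

Definition Lip L f := forall x y, `|f x - f y| <= L * `|x - y|.

Definition fin_avg (zs : seq V) f x : R :=
  (\sum_(z <- zs) f (x + z)) / (size zs)%:R.

(** The operators used below (box averages, steps of a random walk, their
    iterates) are all uniform limits, on functions with a given Lipschitz
    constant, of finite averages of translates by vectors of norm at most [rho].
    Monotonicity, linearity, invariance under translations and, above all,
    commutation (a Fubini theorem without integrals in several variables) are
    inherited from the finite averages. *)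
Definition average (rho : R) (T : (V -> R) -> V -> R) :=
  forall L e, 0 < e -> exists zs : seq V,
    [/\ zs != [::], forall z, z \in zs -> `|z| <= rho &
        forall f, Lip L f -> forall x, `|T f x - fin_avg zs f x| <= e].

Lemma size_gt0R (zs : seq V) : zs != [::] -> 0 < (size zs)%:R :> R.
Proof. by case: zs. Qed.

Lemma sum_cst_seq (zs : seq V) (c : R) : \sum_(z <- zs) c = c * (size zs)%:R.
Proof. by rewrite big_const_seq count_predT iter_addr_0 mulr_natr. Qed.

Lemma fin_avg_le zs f g x c : zs != [::] ->
  (forall z, z \in zs -> f (x + z) <= g (x + z) + c) ->
  fin_avg zs f x <= fin_avg zs g x + c.
Proof.
move=> z0 h; have s0 := size_gt0R z0.
rewrite /fin_avg ler_pdivrMr// mulrDl divfK ?gt_eqF// -sum_cst_seq -big_split/=.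
by rewrite big_seq [leRHS]big_seq; apply: ler_sum.
Qed.

Lemma fin_avg_cst zs c x : zs != [::] -> fin_avg zs (fun=> c) x = c.
Proof.
by move=> z0; rewrite /fin_avg sum_cst_seq mulfK// gt_eqF// size_gt0R.
Qed.

Lemma fin_avg_lin zs (a b : R) f g x :
  fin_avg zs (fun y => a * f y + b * g y) x
  = a * fin_avg zs f x + b * fin_avg zs g x.
Proof. by rewrite /fin_avg big_split/= -!mulr_sumr mulrDl -!mulrA. Qed.

Lemma fin_avg_shift zs f x z :
  fin_avg zs f (x + z) = fin_avg zs (fun y => f (y + z)) x.
Proof.
by rewrite /fin_avg; congr (_ / _); apply: eq_bigr => w _; rewrite addrAC.
Qed.

Lemma fin_avg_comm zs zs' f x :
  fin_avg zs (fin_avg zs' f) x = fin_avg zs' (fin_avg zs f) x.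
Proof.
rewrite /fin_avg -!mulr_suml exchange_big/= mulrAC; congr (_ / _ / _).
by apply: eq_bigr => z _; apply: eq_bigr => w _; rewrite addrAC.
Qed.

Lemma fin_avg_comp zs zs' f x :
  fin_avg zs (fin_avg zs' f) x
  = fin_avg [seq z + z' | z <- zs, z' <- zs'] f x.
Proof.
rewrite /fin_avg size_allpairs big_allpairs_dep -mulr_suml natrM invfM -mulrA.
rewrite [X in _ * X]mulrC; congr (_ * _).
by apply: eq_bigr => z _; apply: eq_bigr => w _; rewrite addrA.
Qed.

Lemma fin_avg_dist zs f g x c : zs != [::] ->
  (forall z, z \in zs -> `|f (x + z) - g (x + z)| <= c) ->
  `|fin_avg zs f x - fin_avg zs g x| <= c.
Proof.
move=> z0 h.
have h1 : fin_avg zs f x <= fin_avg zs g x + c.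
  by apply: fin_avg_le => // z /h; rewrite ler_norml => /andP[_]; lra.
have h2 : fin_avg zs g x <= fin_avg zs f x + c.
  by apply: fin_avg_le => // z /h; rewrite ler_norml => /andP[+ _]; lra.
by rewrite ler_norml; apply/andP; split; lra.
Qed.

Lemma fin_avg_Lip zs f L : zs != [::] -> Lip L f -> Lip L (fin_avg zs f).
Proof.
move=> z0 Lf x y.
have -> : fin_avg zs f y = fin_avg zs (fun w => f (w + (y - x))) x.
  by rewrite -fin_avg_shift subrKC.
apply: fin_avg_dist => // z _; rewrite (le_trans (Lf _ _))//.
by rewrite opprD addNKr opprB.
Qed.

Lemma fin_avg_average zs rho : zs != [::] ->
  (forall z, z \in zs -> `|z| <= rho) -> average rho (fin_avg zs).
Proof.
move=> z0 zr L e e0; exists zs; split => // f _ x.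
by rewrite subrr normr0 ltW.
Qed.

Lemma eps_eq (a b : R) : (forall e, 0 < e -> `|a - b| <= e) -> a = b.
Proof.
move=> h; apply/eqP; rewrite -subr_eq0 -normr_eq0 eq_le normr_ge0 andbT.
by apply/ler_addgt0Pr => e e0; rewrite add0r h.
Qed.

Lemma average_Lip rho T f L : average rho T -> Lip L f -> Lip L (T f).
Proof.
move=> aT Lf x y; apply/ler_addgt0Pr => e e0.
have [|zs [z0 _ /(_ _ Lf) h]] := aT L (e / 2); first lra.
have := fin_avg_Lip z0 Lf x y; have := h x; have := h y.
rewrite !ler_norml => /andP[? ?] /andP[? ?] /andP[? ?]; apply/andP; split; lra.
Qed.

(** The inequality is needed only on the ball of radius [rho], because the
    translations involved are no longer than that; this is what makes local
    inequalities stable under mollification. *)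
Lemma average_le rho T f g L L' x c : average rho T -> Lip L f -> Lip L' g ->
  (forall y, `|y - x| <= rho -> f y <= g y + c) -> T f x <= T g x + c.
Proof.
move=> aT Lf Lg fg; apply/ler_addgt0Pr => e e0.
have LM k h : Lip k h -> k <= Num.max L L' -> Lip (Num.max L L') h.
  by move=> Lh kM u v; apply: le_trans (Lh u v) _; rewrite ler_wpM2r.
have {}Lf := LM _ _ Lf; have {}Lg := LM _ _ Lg.
have [|zs [z0 zr h]] := aT (Num.max L L') (e / 2); first lra.
have : fin_avg zs f x <= fin_avg zs g x + c.
  by apply: fin_avg_le => // z /zr zr'; apply: fg; rewrite addrC addKr.
have := h f (Lf _) x; have := h g (Lg _) x.
rewrite !le_max !lexx orbT => /(_ isT)+ /(_ isT).
rewrite !ler_norml => /andP[? ?] /andP[? ?]; lra.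
Qed.

Lemma average_near rho T f L x : average rho T -> 0 <= L -> Lip L f ->
  `|T f x - f x| <= L * rho.
Proof.
move=> aT L0 Lf; apply/ler_addgt0Pr => e e0.
have [|zs [z0 zr /(_ _ Lf) h]] := aT L e => //.
have : `|fin_avg zs f x - fin_avg zs (fun=> f x) x| <= L * rho.
  apply: fin_avg_dist => // z /zr zr'; apply: le_trans (Lf _ _) _.
  by rewrite addrC addKr ler_wpM2l.
rewrite fin_avg_cst//; have := h x.
rewrite !ler_norml => /andP[? ?] /andP[? ?]; apply/andP; split; lra.
Qed.

Lemma Lip_lin (a b : R) f g L L' : Lip L f -> Lip L' g ->
  Lip (`|a| * L + `|b| * L') (fun y => a * f y + b * g y).
Proof.
move=> Lf Lg x y; rewrite opprD addrACA -!mulrBr mulrDl.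
by rewrite (le_trans (ler_normD _ _))// !normrM -!mulrA lerD// ler_wpM2l.
Qed.

Lemma Lip_le L L' f : L <= L' -> Lip L f -> Lip L' f.
Proof. by move=> LL Lf x y; apply: le_trans (Lf x y) _; rewrite ler_wpM2r. Qed.

Lemma Lip_shift L f z : Lip L f -> Lip L (fun y => f (y + z)).
Proof.
by move=> Lf x y; rewrite (le_trans (Lf _ _))// opprD addrACA subrr addr0.
Qed.

Lemma average_lin rho T (a b : R) f g L L' : average rho T ->
  Lip L f -> Lip L' g ->
  T (fun y => a * f y + b * g y) = (fun y => a * T f y + b * T g y).
Proof.
move=> aT Lf Lg; apply/funext => x; apply: eps_eq => e e0.
pose M := Num.max (Num.max L L') (`|a| * L + `|b| * L').
have k0 : 0 < 1 + `|a| + `|b| by rewrite -addrA ltr_wpDr// addr_ge0.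
have [|zs [z0 zr h]] := aT M (e / (1 + `|a| + `|b|)).
  by rewrite divr_gt0.
have h1 := h _ (Lip_le _ Lf) x; have h2 := h _ (Lip_le _ Lg) x.
have h3 := h _ (Lip_le _ (Lip_lin a b Lf Lg)) x.
rewrite /M !le_max !lexx ?orbT in h1 h2 h3.
move: (h1 isT) (h2 isT) (h3 isT) => {}h1 {}h2 {}h3.
rewrite fin_avg_lin in h3.
set d := e / _ in h1 h2 h3.
have -> : e = d + `|a| * d + `|b| * d.
  by rewrite -[X in X + _ + _]mul1r -!mulrDl /d mulrC divfK// gt_eqF.
have -> : T (fun y => a * f y + b * g y) x - (a * T f x + b * T g x) =
  (T (fun y => a * f y + b * g y) x
   - (a * fin_avg zs f x + b * fin_avg zs g x))
  + a * - (T f x - fin_avg zs f x) + b * - (T g x - fin_avg zs g x) by ring.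
rewrite (le_trans (ler_normD _ _))// lerD//; last by
  rewrite normrM normrN ler_wpM2l.
rewrite (le_trans (ler_normD _ _))// lerD//.
by rewrite normrM normrN ler_wpM2l.
Qed.

Lemma average_shift rho T f L x z : average rho T -> Lip L f ->
  T f (x + z) = T (fun y => f (y + z)) x.
Proof.
move=> aT Lf; apply: eps_eq => e e0.
have [|zs [z0 zr h]] := aT L (e / 2); first lra.
have := h _ Lf (x + z); have := h _ (@Lip_shift _ _ z Lf) x.
rewrite fin_avg_shift !ler_norml => /andP[? ?] /andP[? ?].
by apply/andP; split; lra.
Qed.

Lemma average_id : average 0 id.
Proof.
move=> L e e0; exists [:: 0]; split => //.
  by move=> z; rewrite inE => /eqP ->; rewrite normr0.
move=> f _ x; rewrite /fin_avg big_seq1/= addr0 divr1 subrr normr0.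
exact: ltW.
Qed.

Lemma average_comp rho rho' T T' : average rho T -> average rho' T' ->
  average (rho + rho') (T \o T').
Proof.
move=> aT aT' L e e0.
have [|zs [z0 zr h]] := aT L (e / 2); first lra.
have [|zs' [z0' zr' h']] := aT' L (e / 2); first lra.
exists [seq z + z' | z <- zs, z' <- zs']; split.
- by rewrite -size_eq0 size_allpairs muln_eq0 !size_eq0 negb_or z0.
- move=> _ /allpairsP[[z z'] /= [/zr zz /zr' zz' ->]].
  by rewrite (le_trans (ler_normD _ _))// lerD.
move=> f Lf x; rewrite -fin_avg_comp /=.
have := h _ (average_Lip aT' Lf) x.
have : `|fin_avg zs (T' f) x - fin_avg zs (fin_avg zs' f) x| <= e / 2.
  by apply: fin_avg_dist => // z _; apply: h'.
rewrite !ler_norml => /andP[? ?] /andP[? ?]; apply/andP; split; lra.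
Qed.

(** Two finite averages commute because translations do; the errors made in
    approximating [T] and [T'] are uniform, since both preserve the Lipschitz
    constant. *)
Lemma average_comm rho rho' T T' f L : average rho T -> average rho' T' ->
  Lip L f -> T (T' f) = T' (T f).
Proof.
move=> aT aT' Lf; apply/funext => x; apply: eps_eq => e e0.
have [|zs [z0 zr h]] := aT L (e / 4); first lra.
have [|zs' [z0' zr' h']] := aT' L (e / 4); first lra.
have h1 := h _ (average_Lip aT' Lf) x.
have h2 := h' _ (average_Lip aT Lf) x.
have h3 : `|fin_avg zs (T' f) x - fin_avg zs (fin_avg zs' f) x| <= e / 4.
  by apply: fin_avg_dist => // z _; apply: h'.
have h4 : `|fin_avg zs' (T f) x - fin_avg zs' (fin_avg zs f) x| <= e / 4.
  by apply: fin_avg_dist => // z _; apply: h.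
rewrite fin_avg_comm in h3.
move: h1 h2 h3 h4; rewrite !ler_norml => /andP[? ?] /andP[? ?] /andP[? ?].
by move=> /andP[? ?]; apply/andP; split; lra.
Qed.

Lemma average_iter rho T k : average rho T ->
  average (rho *+ k) (iter k T).
Proof.
move=> aT; elim: k => [|k IH]; first exact: average_id.
by rewrite mulrS; exact: average_comp.
Qed.

End Averages.


(** * Box averages and antiderivatives *)

Section Box.
Context {R : realType} {n : nat}.
Notation V := 'rV[R]_n.
Implicit Types (f : V -> R) (x : V) (L c e h : R) (i : 'I_n).

Lemma coord_le_norm (m k : nat) (A : 'M[R]_(m, k)) (i : 'I_m) (j : 'I_k) : `|A i j| <= `|A|.
Proof.
rewrite [leRHS]/Num.norm/= mx_normrE.
by apply/bigmax_geP; right => /=; exists (i, j).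
Qed.

Lemma norm_le_coord (m k : nat) (A : 'M[R]_(m, k)) c : 0 <= c ->
  (forall (i : 'I_m) (j : 'I_k), `|A i j| <= c) -> `|A| <= c.
Proof.
move=> c0 h; rewrite [leLHS]/Num.norm/= mx_normrE.
by apply/bigmax_leP; split => // -[a b] _ /=.
Qed.

Definition e_ i : V := delta_mx 0 i.

Lemma norm_e i : `|e_ i| <= 1.
Proof.
by apply: norm_le_coord => // a b; rewrite mxE; case: (_ && _); rewrite ?normr1 ?normr0.
Qed.

Lemma lipschitz_continuous (W : normedModType R) (f : W -> R) L :
  (forall u v : W, `|f u - f v| <= L * `|u - v|) -> continuous f.
Proof.
move=> Lf x; apply/cvgrPdist_lt => e e0.
have k0 : 0 < `|L| + 1 by rewrite ltr_wpDl.
near=> y; apply: le_lt_trans (Lf _ _) _.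
apply: (@le_lt_trans _ _ ((`|L| + 1) * `|x - y|)).
  by rewrite ler_wpM2r// (le_trans (ler_norm _))// lerDl.
rewrite mulrC -ltr_pdivlMr//; near: y.
by apply: cvgr_dist_lt; rewrite ?divr_gt0.
Unshelve. all: by end_near. Qed.

Lemma Lip_line L f x v : Lip L f ->
  continuous (fun s : R => f (x + s *: v)).
Proof.
move=> Lf; apply: (@lipschitz_continuous R^o _ (`|L| * `|v|)) => s t.
rewrite (le_trans (Lf _ _))// opprD addrACA subrr add0r -scalerBl normrZ.
rewrite [`|s - t| * _]mulrC mulrA ler_wpM2r// ler_wpM2r//.
exact: ler_norm.
Qed.

Lemma line_quotient f x v s :
  (fun h => h^-1 *: ((f \o shift (x + s *: v)) (h *: v) - f (x + s *: v)))
  = (fun h => h^-1 *: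
      (((fun t : R => f (x + t *: v)) \o shift s) (h *: 1) - f (x + s *: v))).
Proof.
apply/funext => h /=; congr (_ *: (f _ - _)).
have -> : h *: (1 : R) = h by exact: mulr1.
by rewrite scalerDl addrCA.
Qed.

Lemma is_derive_line f x v (s d : R) :
  is_derive (x + s *: v) v f d <-> is_derive s 1 (fun t => f (x + t *: v)) d.
Proof.
by split=> -[] h1 h2; split;
  move: h1 h2; rewrite /derivable /derive line_quotient.
Qed.

Lemma is_derive_line0 f x v (d : R) :
  is_derive x v f d <-> is_derive (0 : R) 1 (fun t => f (x + t *: v)) d.
Proof. by rewrite -is_derive_line scale0r addr0. Qed.

Lemma is_derive_shift (U W : normedModType R) (k : U -> W) (u u' v : U) d :
  is_derive (u + u') v k d <-> is_derive u v (fun w => k (w + u')) d.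
Proof.
have E : (fun h : R => h^-1 *: ((k \o shift (u + u')) (h *: v) - k (u + u')))
  = (fun h => h^-1 *: (((fun w => k (w + u')) \o shift u) (h *: v)
                       - k (u + u'))).
  by apply/funext => h /=; rewrite addrA.
by split=> -[] h1 h2; split; move: h1 h2; rewrite /derivable /derive E.
Qed.

(** A left endpoint [a] is enough: box averages look to the right of [0], and
    their derivative at [0] only needs a neighbourhood. *)
Definition antiderivative (a : R) (G g : R -> R) :=
  forall s, a < s -> is_derive s 1 G (g s).

Lemma is_derive_continuous (G : R -> R) (s d : R) :
  is_derive s 1 G d -> {for s, continuous G}.
Proof. by case=> /derivable1_diffP/differentiable_continuous. Qed.

Lemma antiderivative_MVT (a : R) G g (s t : R) : antiderivative a G g ->
  a < s -> s <= t -> exists2 c, s <= c <= t & G t - G s = g c * (t - s).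
Proof.
move=> Gg as_ st; case: (@MVT_segment _ G g _ _ st).
- by move=> u; rewrite in_itv/= => /andP[su _]; apply: Gg; apply: lt_trans su.
- apply/continuous_in_subspaceT => u; rewrite inE/= in_itv/= => /andP[su _].
  by apply: is_derive_continuous (Gg _ _); apply: lt_le_trans su.
- by move=> c; rewrite in_itv/= => cst ->; exists c.
Qed.

(** The difference of two antiderivatives has derivative zero, so the mean
    value theorem makes it constant. *)
Lemma antiderivative_uniq (a : R) G1 G2 g (s t : R) : antiderivative a G1 g ->
  antiderivative a G2 g -> a < s -> s <= t -> G1 t - G1 s = G2 t - G2 s.
Proof.
move=> h1 h2 as_ st.
have h : antiderivative a (G1 - G2) (cst 0).
  move=> u au; have d1 := h1 u au; have d2 := h2 u au.
  by apply: is_derive_eq; rewrite subrr.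
have [c _] := antiderivative_MVT h as_ st.
rewrite mul0r !fctE; lra.
Qed.

Lemma antiderivative_exists (g : R -> R) : continuous g ->
  exists G, antiderivative (-1) G g.
Proof.
move=> cg.
exists (fun b : R => (\int[lebesgue_measure]_(t in [set` `[-1, b]]) (g t))%R).
move=> s s1.
have s_lt : s < s + 1 by rewrite ltrDl.
have gi : lebesgue_measure.-integrable `[-1, s + 1] (EFin \o g).
  apply: continuous_compact_integrable; first exact: segment_compact.
  exact/continuous_subspaceT.
have [dG dGE] := continuous_FTC1_closed s_lt gi s1 (cg s).
by split=> //; rewrite -dGE derive1E.
Qed.

Definition primitive (g : R -> R) : R -> R :=
  xget (fun=> 0) [set G | antiderivative (-1) G g].

(** An average over a segment, written with an antiderivative: which one does
    not matter, and the fundamental theorem of calculus applies at once. *)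
Definition box i h f x : R :=
  let G := primitive (fun s => f (x + s *: e_ i)) in (G h - G 0) / h.

Lemma boxE i h f L G x a : -1 <= a < 0 -> 0 <= h -> Lip L f ->
  antiderivative a G (fun s => f (x + s *: e_ i)) ->
  box i h f x = (G h - G 0) / h.
Proof.
move=> /andP[a1 a0] h0 Lf hG; rewrite /box; congr (_ / _).
have [H hH] := antiderivative_exists (@Lip_line L f x (e_ i) Lf).
have hP := @xgetPex (R -> R) (fun=> 0)
  [set K | antiderivative (-1) K (fun s => f (x + s *: e_ i))]
  (ex_intro _ H hH).
apply: (@antiderivative_uniq a _ _ (fun s => f (x + s *: e_ i))) => //.
by move=> s sa; apply: hP; apply: le_lt_trans sa.
Qed.

(** Riemann sums: on each of [N] subintervals the mean value theorem replaces
    the increment of the antiderivative by a value of [f], which differs from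
    the value at the left endpoint by at most [L * h / N]. *)
Lemma box_average i h : 0 < h -> average h (box i h).
Proof.
move=> h0 L e e0.
pose N := (Num.truncn (`|L| * h / e)).+1.
have N0 : 0 < N%:R :> R by rewrite ltr0n.
have Ne : `|L| * (h / N%:R) <= e.
  rewrite mulrA ler_pdivrMr// [e * _]mulrC -ler_pdivrMr// ltW//.
  by rewrite /N truncnS_gt.
pose p (j : nat) : R := j%:R * (h / N%:R).
have p0 j : 0 <= p j.
  by apply: mulr_ge0; rewrite ?ler0n// divr_ge0// ltW.
have pS j : p j.+1 = p j + h / N%:R by rewrite /p -natr1 mulrDl mul1r.
have pN : p N = h by rewrite /p mulrC divfK// gt_eqF.
exists [seq p j *: e_ i | j <- iota 0 N]; split => //.
- move=> z /mapP[j + ->]; rewrite mem_iota add0n => /andP[_ jN].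
  have pjh : p j <= h.
    rewrite -[leRHS]pN /p ler_wpM2r ?ler_nat ?(ltnW jN)//.
    by rewrite divr_ge0 ?ler0n ?(ltW h0).
  by rewrite normrZ ger0_norm// -[leRHS]mulr1 ler_pM ?norm_e.
move=> f Lf x.
have [G hG] := antiderivative_exists (@Lip_line L f x (e_ i) Lf).
rewrite (@boxE i h f L G x (-1) _ (ltW h0) Lf hG) ?lexx ?ltrN10// /fin_avg size_map size_iota.
rewrite big_map -{1}[iota 0 N]/(index_iota 0 N).
have -> : G h - G 0 = \sum_(0 <= j < N) (G (p j.+1) - G (p j)).
  rewrite (telescope_sumr (fun j => G (p j)))// pN.
  by congr (_ - G _); rewrite /p mul0r.
pose q j := (G (p j.+1) - G (p j)) * (N%:R / h).
have qE j : `|q j - f (x + p j *: e_ i)| <= e.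
  have [||c /andP[c1 c2] E] := @antiderivative_MVT _ _ _ (p j) (p j.+1) hG.
  - by apply: lt_le_trans (p0 j); rewrite ltrN10.
  - by rewrite pS lerDl divr_ge0// ltW.
  rewrite /q E pS addrAC subrr add0r -mulrA.
  rewrite [_ * (N%:R / h)](_ : _ = 1) ?mulr1; last first.
    by rewrite mulrA divfK ?mulfV ?gt_eqF.
  apply: le_trans (Lf _ _) _.
  rewrite opprD addrACA subrr add0r -scalerBl normrZ.
  apply: le_trans Ne; apply: (@le_trans _ _ (`|L| * (`|c - p j| * `|e_ i|))).
    by rewrite ler_wpM2r ?mulr_ge0// ler_norm.
  rewrite ler_wpM2l// -[leRHS]mulr1 ler_pM ?norm_e//.
  by rewrite ger0_norm; move: c2; rewrite ?pS; lra.
have -> : (\sum_(0 <= j < N) (G (p j.+1) - G (p j))) / h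
   = (\sum_(0 <= j < N) q j) / N%:R.
  rewrite -!mulr_suml -mulrA; congr (_ * _).
  by rewrite mulrAC mulfV ?gt_eqF// mul1r.
rewrite -mulrBl -sumrB normrM normfV (ger0_norm (ltW N0)).
rewrite ler_pdivrMr// (le_trans (ler_norm_sum _ _ _))//.
rewrite (le_trans (ler_sum _ (fun j _ => qE j)))//.
by rewrite big_const_nat subn0 iter_addr_0 mulr_natr.
Qed.

Definition dq i h f x : R := (f (x + h *: e_ i) - f x) / h.

(** Fundamental theorem of calculus: along direction [i] the box average is
    [(G (s + h) - G s) / h] for a fixed antiderivative [G].  Thus box averages
    turn a difference quotient of [f] into a genuine partial derivative, for
    every Lipschitz [f]. *)
Lemma box_derive i h f L x : 0 < h -> Lip L f ->
  is_derive x (e_ i) (box i h f) (dq i h f x).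
Proof.
move=> h0 Lf; apply/is_derive_line0.
have [G hG] := antiderivative_exists (@Lip_line L f x (e_ i) Lf).
have dG (t : R) : -1 < t -> is_derive t 1 G (f (x + t *: e_ i)) by exact: hG.
have d0 := dG 0 (ltrN10 R).
have dh : is_derive (0 + h) 1 G (f (x + h *: e_ i)).
  by rewrite add0r; apply: dG; lra.
have {}dh := (@is_derive_shift _ _ G 0 h 1 _).1 dh.
have near0 : \forall s \near (0 : R), `|s| < 2^-1.
  by apply: (@nbhs0_lt R R^o); rewrite invr_gt0.
apply: (@near_eq_is_derive _ _ _ (h^-1 \*: ((fun s => G (s + h)) - G))).
  near=> s.
  rewrite (@boxE i h f L (fun t => G (t + s)) (x + s *: e_ i) (-2^-1)) ?ltW//=.
  - by rewrite add0r !fctE [h + s]addrC [LHS]mulrC.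
  - by lra.
  - move=> t t2; have ts : -1 < t + s.
      have : `|s| < 2^-1 by near: s; exact: near0.
      by rewrite ltr_norml => /andP[? ?]; lra.
    apply/is_derive_shift.
    by rewrite -addrA -scalerDl [s + t]addrC; apply: dG.
apply: is_derive_eq.
by rewrite /dq scale0r addr0 /GRing.scale/= mulrC.
Unshelve. all: by end_near. Qed.

End Box.


(** * Taylor expansions along partial derivatives *)

Section Taylor.
Context {R : realType} {n : nat}.
Notation V := 'rV[R]_n.
Implicit Types (f : V -> R) (x y z : V) (M c h : R) (i j : 'I_n).

Lemma e_E (k : 'I_1) i j : (e_ i : V) k j = (j == i)%:R.
Proof. by rewrite /e_ mxE (ord1 k) eqxx. Qed.

Lemma MVT_any (F dF : R -> R) (a b : R) :
  (forall s : R, is_derive s 1 F (dF s)) ->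
  exists2 c, `|c - a| <= `|b - a| & F b - F a = dF c * (b - a).
Proof.
move=> dF_; have cF s : {for s, continuous F} by exact: is_derive_continuous (dF_ s).
have H u v : u <= v -> exists2 c, u <= c <= v & F v - F u = dF c * (v - u).
  move=> uv; have cuv : {within `[u, v], continuous F}.
    by apply: continuous_subspaceT => s; apply: cF.
  have [c] := MVT_segment uv (fun s _ => dF_ s) cuv.
  by rewrite in_itv/=; exists c.
have [ab|ba] := leP a b.
- by have [c /andP[ac cb] E] := H _ _ ab; exists c => //; rewrite !ger0_norm; lra.
- have [c /andP[bc ca] E] := H _ _ (ltW ba); exists c.
    by rewrite !ler0_norm; lra.
  by rewrite -opprB E -mulrN opprB.
Qed.

(** Derivatives are recognized from a quadratic error bound, which Taylor
    expansions provide directly. *)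
Lemma quadratic_is_derive (F : R -> R) (s d K : R) :
  (forall t, `|F (t + s) - F s - t * d| <= K * t ^+ 2) -> is_derive s 1 F d.
Proof.
move=> h.
suff E : (fun t : R => t^-1 *: ((F \o shift s) (t *: 1) - F s)) @ 0^' --> d.
  by split; [apply/cvg_ex; exists d | apply/cvg_lim].
apply/cvgrPdist_lt => e e0.
have K0 : 0 < `|K| + 1 by rewrite ltr_wpDl.
near=> t.
have t0 : t != 0 by near: t; exact: nbhs_dnbhs_neq.
have te : `|t| < e / (`|K| + 1).
  by near: t; apply: (@dnbhs0_lt R R^o); rewrite divr_gt0.
rewrite /= [t *: 1]mulr1 [_ *: _]mulrC distrC.
rewrite (_ : _ - d = (F (t + s) - F s - t * d) / t); last first.
  by rewrite [RHS]mulrBl mulrAC mulfV// mul1r.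
rewrite normrM normfV ltr_pdivrMr ?normr_gt0//.
apply: le_lt_trans (h t) _; rewrite -[t ^+ 2]real_normK ?num_real// expr2 mulrA.
rewrite ltr_pM2r ?normr_gt0//.
apply: (@le_lt_trans _ _ ((`|K| + 1) * `|t|)).
  by rewrite ler_wpM2r// (le_trans (ler_norm _))// lerDl.
by rewrite mulrC -ltr_pdivlMr.
Unshelve. all: by end_near. Qed.

Definition gradient f (G : 'I_n -> V -> R) :=
  forall x i, is_derive x (e_ i) f (G i x).

Definition lin (G : 'I_n -> V -> R) x y := \sum_i G i x * y 0 i.

Definition quad (H : 'I_n -> 'I_n -> V -> R) x y :=
  \sum_i (\sum_j H i j x * y 0 j) * y 0 i.

Lemma sum_le_const (F : 'I_n -> R) c : (forall i, F i <= c) ->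
  \sum_i F i <= n%:R * c.
Proof.
move=> h; have -> : n%:R * c = \sum_(i < n) c.
  by rewrite sumr_const card_ord mulr_natl.
exact: ler_sum.
Qed.

(** The increment is telescoped one coordinate at a time, and the mean value
    theorem is applied along each coordinate direction. *)
Lemma taylor1 f G M x y : gradient f G -> (forall i, Lip M (G i)) ->
  `|f (x + y) - f x - lin G x y| <= n%:R * `|M| * `|y| ^+ 2.
Proof.
move=> fG GM.
pose z (k : nat) : V := \row_j (if (j < k)%N then y 0 j else 0).
have z0 : z 0%N = 0 by apply/rowP => j; rewrite !mxE.
have zn : z n = y by apply/rowP => j; rewrite !mxE ltn_ord.
have -> : f (x + y) - f x = \sum_(i < n) (f (x + z i.+1) - f (x + z i)).
  rewrite -(big_mkord xpredT (fun k => f (x + z k.+1) - f (x + z k))).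
  by rewrite (telescope_sumr (fun k => f (x + z k)))// zn z0 addr0.
rewrite -sumrB (le_trans (ler_norm_sum _ _ _))// -mulrA.
apply: sum_le_const => i.
have zS : z i.+1 = z i + y 0 i *: e_ i.
  apply/rowP => j; rewrite !(e_E, mxE) ltnS leq_eqVlt -val_eqE.
  by case: ltngtP => [||/val_inj ->]/=; rewrite ?mulr0 ?mulr1 ?addr0 ?add0r.
have [|c] := @MVT_any (fun s => f (x + z i + s *: e_ i))
    (fun s => G i (x + z i + s *: e_ i)) 0 (y 0 i).
  by move=> s; apply/is_derive_line.
rewrite !subr0 scale0r addr0 -addrA -zS => cy -> .
rewrite -mulrBl normrM expr2 mulrA ler_pM ?coord_le_norm//.
apply: le_trans (GM _ _ _) _; rewrite [_ - x]addrC -?addrA addKr.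
apply: (@le_trans _ _ (`|M| * `|z i + c *: e_ i|)).
  by rewrite ler_wpM2r// ler_norm.
rewrite ler_wpM2l//; apply: norm_le_coord => // a j; rewrite !(e_E, mxE).
case: (eqVneq j i) => [->|ji]; rewrite ?ltnn ?mulr1 ?add0r.
  by rewrite (le_trans cy)// coord_le_norm.
rewrite mulr0 addr0; case: ifP => _; first exact: coord_le_norm.
by rewrite normr0.
Qed.

Lemma lin_scale G x (t : R) y : lin G x (t *: y) = t * lin G x y.
Proof. by rewrite mulr_sumr; apply: eq_bigr => i _; rewrite mxE mulrCA. Qed.

(** Subtracting its second-order expansion from [s |-> f (x + s *: y)] leaves
    a function whose derivative is controlled by [taylor1] applied to the
    partial derivatives. *)
Lemma taylor2 f G H M x y : gradient f G -> (forall i, gradient (G i) (H i)) ->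
  (forall i, Lip M (G i)) -> (forall i j, Lip M (H i j)) ->
  `|f (x + y) - f x - lin G x y - quad H x y / 2|
    <= (n%:R * `|y|) * (n%:R * `|M| * `|y| ^+ 2).
Proof.
move=> fG GH GM HM.
pose Q := quad H x y; pose a := lin G x y.
pose psi (s : R) := f (x + s *: y) - f x - s * a - s ^+ 2 * Q / 2.
pose dpsi (s : R) := lin G (x + s *: y) y - a - s * Q.
have dpsiP (s : R) : is_derive s 1 psi (dpsi s).
  apply: (@quadratic_is_derive _ _ _ (n%:R * `|M| * `|y| ^+ 2 + `|Q|)) => t.
  have -> : psi (t + s) - psi s - t * dpsi s =
    (f (x + s *: y + t *: y) - f (x + s *: y) - lin G (x + s *: y) (t *: y))
    - t ^+ 2 * Q / 2.
    by rewrite /psi /dpsi lin_scale scalerDl [t *: y + _]addrC addrA; field.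
  apply: le_trans (ler_normB _ _) _; rewrite mulrDl lerD//.
    apply: le_trans (taylor1 _ _ fG GM) _.
    by rewrite normrZ exprMn real_normK ?num_real// [t ^+ 2 * _]mulrC [leLHS]mulrA.
  have -> : `|t ^+ 2 * Q / 2| = t ^+ 2 * (`|Q| / 2).
    rewrite -mulrA normrM (ger0_norm (sqr_ge0 t)) normrM normfV.
    by rewrite (ger0_norm (ler0n _ 2)).
  by have := mulr_ge0 (sqr_ge0 t) (normr_ge0 Q); lra.
have [c] := MVT_any 0 1 dpsiP.
rewrite !subr0 normr1 mulr1 => c1.
have -> : psi 0 = 0.
  by rewrite /psi scale0r addr0 subrr expr0n/= !mul0r !subr0.
rewrite subr0 {1}/psi scale1r expr1n !mul1r => ->.
have -> : dpsi c = \sum_i (G i (x + c *: y) - G i x - lin (H i) x (c *: y)) * y 0 i.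
  rewrite /dpsi /a /Q /quad mulr_sumr -!sumrB; apply: eq_bigr => i _.
  by rewrite lin_scale /lin !mulrBl mulrA.
apply: le_trans (ler_norm_sum _ _ _) _; rewrite -mulrA; apply: sum_le_const => i.
rewrite normrM mulrC ler_pM// ?coord_le_norm//.
apply: le_trans (taylor1 _ _ (GH i) (HM i)) _.
rewrite ler_wpM2l ?mulr_ge0 ?ler0n// normrZ ler_pXn2r ?nnegrE ?mulr_ge0//.
by rewrite -[leRHS]mul1r ler_wpM2r.
Qed.

End Taylor.


(** * The random walk attached to a second-order operator *)

Section Walk.
Context {R : realType} {n : nat}.
Notation V := 'rV[R]_n.
Implicit Types (f : V -> R) (x y z : V) (M : R) (i j : 'I_n).

Lemma linD (G : 'I_n -> V -> R) x y z : lin G x (y + z) = lin G x y + lin G x z.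
Proof. by rewrite -big_split; apply: eq_bigr => i _; rewrite mxE mulrDr. Qed.

Lemma linN (G : 'I_n -> V -> R) x y : lin G x (- y) = - lin G x y.
Proof. by rewrite -sumrN; apply: eq_bigr => i _; rewrite mxE mulrN. Qed.

Lemma lin_bound (G : 'I_n -> V -> R) M x y : (forall i, `|G i x| <= M) ->
  `|lin G x y| <= n%:R * (M * `|y|).
Proof.
move=> GM; apply: le_trans (ler_norm_sum _ _ _) _; apply: sum_le_const => i.
by rewrite normrM ler_pM// coord_le_norm.
Qed.

Lemma quad_scale (H : 'I_n -> 'I_n -> V -> R) x (t : R) y :
  quad H x (t *: y) = t ^+ 2 * quad H x y.
Proof.
rewrite /quad mulr_sumr; apply: eq_bigr => i _.
by rewrite -/(lin (H i) x _) lin_scale mxE -/(lin (H i) x _); ring.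
Qed.

(** The parallelogram law cancels the cross terms between drift and noise when
    the two endpoints of a step are averaged. *)
Lemma quad_parallelogram (H : 'I_n -> 'I_n -> V -> R) x y z :
  quad H x (y + z) + quad H x (y - z) = 2 * quad H x y + 2 * quad H x z.
Proof.
rewrite /quad !mulr_sumr -!big_split/=; apply: eq_bigr => i _.
rewrite -!/(lin (H i) x _) !linD linN !mxE; ring.
Qed.

Lemma quad_bound (H : 'I_n -> 'I_n -> V -> R) M x y : (forall i j, `|H i j x| <= M) ->
  `|quad H x y| <= n%:R * (n%:R * (M * `|y|) * `|y|).
Proof.
move=> HM; apply: (@lin_bound (fun i z => lin (H i) z y)) => i.
exact: lin_bound.
Qed.

Variables (b : V) (es : seq V).

(** The noise has size [sqrt (2 * m * tau)], where [m] is the number of vectors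
    [e]: averaging over the [m] vectors and over both signs then contributes
    [tau] times the sum of the second derivatives along the [e]. *)
Definition step_size (tau : R) : R := Num.sqrt (2 * (size es)%:R * tau).

Definition steps tau : seq V :=
  [seq tau *: b + step_size tau *: e | e <- es] ++
  [seq tau *: b - step_size tau *: e | e <- es].

Definition walk tau : (V -> R) -> V -> R := fin_avg (steps tau).

(** The operator [b . Dphi + sum_e D^2phi(e, e)] generated by the walk, evaluated
    on first and second derivatives [G] and [H] given separately. *)
Definition walk_op (G : 'I_n -> V -> R) H x : R :=
  lin G x b + \sum_(e <- es) quad H x e.

Hypothesis es0 : es != [::].

Lemma steps_neq0 tau : steps tau != [::].
Proof. by rewrite /steps; case: (es) es0. Qed.

Let m0 : 0 < (size es)%:R :> R. Proof. exact: size_gt0R. Qed.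

Lemma walk_error tau f x (c : R) (D : V -> R) :
  (forall e, e \in es ->
     `|(f (x + (tau *: b + step_size tau *: e))
        + f (x + (tau *: b - step_size tau *: e))) / 2 - D e| <= c) ->
  `|walk tau f x - (\sum_(e <- es) D e) / (size es)%:R| <= c.
Proof.
move=> h; rewrite /walk /fin_avg /steps size_cat !size_map big_cat/= !big_map.
rewrite -big_split/= natrD -mulr2n -[_ *+ 2]mulr_natl invfM mulrA.
rewrite -mulrBl mulr_suml -sumrB normrM normfV (ger0_norm (ltW m0)).
rewrite ler_pdivrMr//; apply: le_trans (ler_norm_sum _ _ _) _.
rewrite -sum_cst_seq big_seq [leRHS]big_seq; apply: ler_sum => e ees.
exact: h.
Qed.

Lemma sqrt_tau (tau : R) : 0 < tau <= 1 -> let r := Num.sqrt tau in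
  [/\ 0 <= r, r ^+ 2 = tau & tau <= r].
Proof.
move=> /andP[t0 t1] r; have r2 : r ^+ 2 = tau by rewrite sqr_sqrtr// ltW.
have r0 : 0 <= r by rewrite sqrtr_ge0.
split=> //; rewrite -r2 expr2 -[leRHS]mul1r ler_wpM2r//.
by rewrite -sqrtr1 ler_sqrt.
Qed.

Lemma step_bound : exists2 K : R, 0 <= K & forall (tau : R) e, 0 < tau <= 1 ->
  e \in es -> `|tau *: b + step_size tau *: e| <= K * Num.sqrt tau /\
              `|tau *: b - step_size tau *: e| <= K * Num.sqrt tau.
Proof.
have s0 : 0 <= Num.sqrt (2 * (size es)%:R) :> R by rewrite sqrtr_ge0.
exists (`|b| + Num.sqrt (2 * (size es)%:R) * \sum_(e <- es) `|e|).
  by rewrite addr_ge0// mulr_ge0// sumr_ge0.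
move=> tau e t01 ees; have [r0 r2 tr] := sqrt_tau t01.
have {t01} /andP[t0 t1] := t01.
have h : `|tau *: b| + `|step_size tau *: e| <=
  (`|b| + Num.sqrt (2 * (size es)%:R) * \sum_(e <- es) `|e|) * Num.sqrt tau.
  rewrite mulrDl lerD//; first by rewrite normrZ gtr0_norm// mulrC ler_wpM2l.
  rewrite normrZ /step_size [Num.sqrt (_ * tau)]sqrtrM ?mulr_ge0// ger0_norm ?mulr_ge0//.
  rewrite [_ * Num.sqrt tau * `|e|]mulrAC ler_wpM2r// ler_wpM2l//.
  by rewrite (big_rem e)//= lerDl sumr_ge0.
by split; [apply: le_trans h; apply: ler_normD|apply: le_trans h; apply: ler_normB].
Qed.

(** Second-order Taylor expansion at distance [O(sqrt tau)]: first-order noise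
    terms cancel by symmetry, and [tau ^+ 2 <= tau * sqrt tau]. *)
Lemma walk_consistent M : 0 <= M -> exists2 C : R, 0 <= C &
  forall f G H, gradient f G -> (forall i, gradient (G i) (H i)) ->
    (forall i, Lip M (G i)) -> (forall i j, Lip M (H i j)) ->
    (forall i j x, `|H i j x| <= M) ->
  forall (tau : R) x, 0 < tau <= 1 ->
    `|walk tau f x - f x - tau * walk_op G H x| <= C * (tau * Num.sqrt tau).
Proof.
move=> M0; have [K K0 hK] := step_bound.
pose c1 := n%:R * K * (n%:R * M * K ^+ 2).
pose c2 := n%:R * (n%:R * (M * `|b|) * `|b|).
have c10 : 0 <= c1 by rewrite /c1 !mulr_ge0 ?exprn_ge0.
have c20 : 0 <= c2 by rewrite /c2 !mulr_ge0.
exists (c1 + c2); first by rewrite addr_ge0.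
move=> f G H fG GH GM HM Hb tau x t01; have [r0 r2 tr] := sqrt_tau t01.
set r := Num.sqrt tau in r0 r2 tr hK *.
have {}hK : forall e, e \in es -> _ := fun e => hK tau e t01.
have t0 : 0 < tau by case/andP: t01.
have -> : walk tau f x - f x - tau * walk_op G H x = walk tau f x -
  (\sum_(e <- es) (f x + tau * lin G x b + (size es)%:R * tau * quad H x e))
   / (size es)%:R.
  rewrite big_split/= sum_cst_seq -mulr_sumr /walk_op.
  by field; rewrite gt_eqF.
apply: walk_error => e ees; have [h1 h2] := hK e ees.
set a := tau *: b in h1 h2 *; set c := step_size tau *: e in h1 h2 *.
have T y : `|y| <= K * r -> `|f (x + y) - f x - lin G x y - quad H x y / 2|
    <= c1 * (tau * r).
  move=> yK; apply: le_trans (taylor2 _ _ fG GH GM HM) _.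
  rewrite (ger0_norm M0) (_ : c1 * _ = n%:R * (K * r) * (n%:R * M * (K * r) ^+ 2)).
    apply: ler_pM; rewrite ?mulr_ge0 ?exprn_ge0 ?ler_wpM2l ?mulr_ge0//.
    by rewrite ler_pXn2r ?nnegrE ?mulr_ge0.
  by rewrite /c1 -r2; ring.
move: (T _ h1) (T _ h2).
have E1 : lin G x (a + c) = tau * lin G x b + lin G x c by rewrite linD lin_scale.
have E2 : lin G x (a - c) = tau * lin G x b - lin G x c.
  by rewrite linD linN lin_scale.
have E3 := quad_parallelogram H x a c.
have E4 : quad H x a = tau ^+ 2 * quad H x b by rewrite quad_scale.
have E5 : quad H x c = 2 * (size es)%:R * tau * quad H x e.
  rewrite quad_scale sqr_sqrtr// !mulr_ge0 ?ler0n// ltW//.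
have E6 : `|tau ^+ 2 * quad H x b| <= c2 * (tau * r).
  rewrite normrM mulrC ler_pM// ?quad_bound//.
  by rewrite normrX expr2 gtr0_norm// ler_wpM2l// ltW.
rewrite E1 E2; move: E3 E6; rewrite E4 E5.
have : 0 <= c2 * (tau * r) by rewrite !mulr_ge0// ltW.
set q1 := quad H x (a + c); set q2 := quad H x (a - c).
set f1 := f (x + (a + c)); set f2 := f (x + (a - c)).
set t1 := tau ^+ 2 * _; set t2 := 2 * _ * _ * _.
rewrite mulrDl.
have -> : (size es)%:R * tau * quad H x e = t2 / 2 by rewrite /t2; field.
rewrite !ler_norml => c0 E /andP[? ?] /andP[? ?] /andP[? ?].
by apply/andP; split; lra.
Qed.

(** The companion of [walk_consistent] for functions that are one derivative less
    regular: it is applied to the derivatives of mollified functions. *)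
Lemma walk_lip_time M : 0 <= M -> exists2 C : R, 0 <= C &
  forall f G, gradient f G -> (forall i, Lip M (G i)) ->
    (forall i x, `|G i x| <= M) ->
  forall (tau : R) x, 0 < tau <= 1 -> `|walk tau f x - f x| <= C * tau.
Proof.
move=> M0; have [K K0 hK] := step_bound.
pose c1 := n%:R * M * K ^+ 2.
pose c2 := n%:R * (M * `|b|).
have c10 : 0 <= c1 by rewrite /c1 !mulr_ge0 ?exprn_ge0.
have c20 : 0 <= c2 by rewrite /c2 !mulr_ge0.
exists (c1 + c2); first by rewrite addr_ge0.
move=> f G fG GM Gb tau x t01; have [r0 r2 tr] := sqrt_tau t01.
set r := Num.sqrt tau in r0 r2 tr hK *.
have {}hK : forall e, e \in es -> _ := fun e => hK tau e t01.
have t0 : 0 < tau by case/andP: t01.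
have -> : f x = (\sum_(e <- es) f x) / (size es)%:R.
  by rewrite sum_cst_seq mulfK// gt_eqF.
apply: walk_error => e ees; have [h1 h2] := hK e ees.
set a := tau *: b in h1 h2 *; set c := step_size tau *: e in h1 h2 *.
have T y : `|y| <= K * r -> `|f (x + y) - f x - lin G x y| <= c1 * tau.
  move=> yK; apply: le_trans (taylor1 _ _ fG GM) _.
  rewrite (ger0_norm M0) (_ : c1 * _ = n%:R * M * (K * r) ^+ 2).
    by rewrite ler_wpM2l ?mulr_ge0// ler_pXn2r ?nnegrE ?mulr_ge0.
  by rewrite /c1 -r2; ring.
move: (T _ h1) (T _ h2).
have E1 : lin G x (a + c) = tau * lin G x b + lin G x c by rewrite linD lin_scale.
have E2 : lin G x (a - c) = tau * lin G x b - lin G x c.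
  by rewrite linD linN lin_scale.
have E6 : `|tau * lin G x b| <= c2 * tau.
  by rewrite normrM mulrC ler_pM// ?lin_bound// gtr0_norm.
rewrite E1 E2; move: E6.
set f1 := f (x + (a + c)); set f2 := f (x + (a - c)).
rewrite mulrDl !ler_norml => /andP[? ?] /andP[? ?] /andP[? ?].
by apply/andP; split; lra.
Qed.

End Walk.


(** * Mollification by iterated box averages *)

Section Smoothing.
Context {R : realType} {n : nat}.
Notation V := 'rV[R]_n.
Implicit Types (f : V -> R) (x y z : V) (L M c h : R) (i j k : 'I_n).

Definition smooth h (l : seq 'I_n) f : V -> R :=
  foldr (fun i g => box i h g) f l.

Lemma smooth_average h l : 0 < h -> average (h *+ size l) (smooth h l).
Proof.
move=> h0; elim: l => [|i l IH]; first exact: average_id.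
by rewrite [size _]/= mulrS; apply: (average_comp (box_average i h0) IH).
Qed.

(** Box averages commute, so that a box average in any direction of the list can
    be moved to the front, where it can be differentiated. *)
Lemma smooth_rem h l i f L : 0 < h -> Lip L f -> i \in l ->
  smooth h l f = box i h (smooth h (rem i l) f).
Proof.
move=> h0 Lf; elim: l => //= j l IH; rewrite inE eq_sym.
case: eqVneq => [->//|ji] /= /IH ->.
have aS := smooth_average (rem i l) h0.
exact: (average_comm (box_average j h0) (box_average i h0) (average_Lip aS Lf)).
Qed.

Lemma dq_lin i h f : dq i h f = fun x => h^-1 * f (x + h *: e_ i) + (- h^-1) * f x.
Proof. by apply/funext => x; rewrite /dq mulrC mulrBr mulNr. Qed.

Lemma dq_Lip i h f L : 0 < h -> Lip L f -> Lip (2 / h * L) (dq i h f).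
Proof.
move=> h0 Lf; rewrite dq_lin.
have -> : 2 / h * L = `|h^-1| * L + `|- h^-1| * L.
  by rewrite normrN gtr0_norm ?invr_gt0//; ring.
by apply: Lip_lin => //; apply: Lip_shift.
Qed.

Lemma dq_bound i h f L x : 0 < h -> 0 <= L -> Lip L f -> `|dq i h f x| <= L.
Proof.
move=> h0 L0 Lf; rewrite /dq normrM normfV (gtr0_norm h0) ler_pdivrMr//.
rewrite (le_trans (Lf _ _))// addrC addKr ler_wpM2l// normrZ (gtr0_norm h0).
by rewrite -[leRHS]mulr1 ler_wpM2l ?norm_e// ltW.
Qed.

Lemma average_dq rho T i h f L : average rho T -> Lip L f ->
  T (dq i h f) = dq i h (T f).
Proof.
move=> aT Lf; rewrite !dq_lin.
rewrite (average_lin _ _ aT (@Lip_shift _ _ _ _ (h *: e_ i) Lf) Lf).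
by apply/funext => x; rewrite (average_shift _ _ aT Lf).
Qed.

Lemma average_bound rho T f L c x : average rho T -> Lip L f ->
  (forall y, `|f y| <= c) -> `|T f x| <= c.
Proof.
move=> aT Lf fc.
have T0 : T (fun=> 0) x = 0.
  have L0 : Lip 0 (fun _ : V => 0 : R) by move=> u v; rewrite subrr normr0 mul0r.
  by have := average_lin 0 0 aT L0 L0; under eq_fun do rewrite !mul0r addr0;
     move=> ->; rewrite !mul0r addr0.
have L0 : Lip 0 (fun _ : V => 0 : R) by move=> u v; rewrite subrr normr0 mul0r.
have h1 : T f x <= T (fun=> 0) x + c.
  apply: (average_le aT Lf L0) => y _; rewrite add0r.
  by apply: le_trans (fc y); rewrite ler_norm.
have h2 : T (fun=> 0) x <= T f x + c.
  apply: (average_le aT L0 Lf) => y _; have := fc y.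
  by rewrite ler_norml => /andP[+ _]; lra.
by rewrite T0 in h1 h2; rewrite ler_norml; apply/andP; split; lra.
Qed.

(** Differentiating consumes one box average and leaves a difference quotient,
    which is again Lipschitz: the lemma can be iterated as long as the list of
    directions lasts. *)
Lemma smooth_gradient h l f L : 0 < h -> Lip L f -> (forall i, i \in l) ->
  gradient (smooth h l f) (fun i => smooth h (rem i l) (dq i h f)).
Proof.
move=> h0 Lf il x i; rewrite (smooth_rem h0 Lf (il i)).
have aS := smooth_average (rem i l) h0.
by rewrite (average_dq _ _ aS Lf); apply: box_derive (average_Lip aS Lf).
Qed.

Lemma fin_avg_is_average (zs : seq V) : zs != [::] ->
  average (\sum_(z <- zs) `|z|) (fin_avg zs).
Proof.
move=> z0; apply: fin_avg_average => // z zz.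
by rewrite (big_rem z)//= lerDl sumr_ge0.
Qed.

Section walk_op.
Variables (b : V) (es : seq V).

Lemma fin_avg_walk_op (zs : seq V) G H x :
  fin_avg zs (walk_op b es G H) x =
  walk_op b es (fun i => fin_avg zs (G i)) (fun i j => fin_avg zs (H i j)) x.
Proof.
rewrite /fin_avg /walk_op /lin /quad big_split/= mulrDl; congr (_ + _).
  rewrite exchange_big/= mulr_suml; apply: eq_bigr => i _.
  by rewrite -mulr_suml mulrAC.
rewrite exchange_big/= mulr_suml; apply: eq_bigr => e _.
rewrite exchange_big/= mulr_suml; apply: eq_bigr => i _.
rewrite -mulr_suml mulrAC; congr (_ * _).
rewrite exchange_big/= mulr_suml; apply: eq_bigr => j _.
by rewrite -mulr_suml mulrAC.
Qed.

Lemma walk_opB G H G' H' x : walk_op b es G H x - walk_op b es G' H' x =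
  walk_op b es (fun i y => G i y - G' i y) (fun i j y => H i j y - H' i j y) x.
Proof.
rewrite /walk_op /lin /quad opprD addrACA -!sumrB; congr (_ + _).
  by apply: eq_bigr => i _; rewrite mulrBl.
apply: eq_bigr => e _; rewrite -sumrB; apply: eq_bigr => i _.
rewrite -mulrBl -sumrB; congr (_ * _).
by apply: eq_bigr => j _; rewrite mulrBl.
Qed.

Lemma walk_op_bound G H M x :
  (forall i, `|G i x| <= M) -> (forall i j, `|H i j x| <= M) ->
  `|walk_op b es G H x| <=
    M * (n%:R * `|b| + \sum_(e <- es) n%:R * (n%:R * `|e| * `|e|)).
Proof.
move=> GM HM; apply: le_trans (ler_normD _ _) _; rewrite mulrDr lerD//.
  by apply: le_trans (lin_bound _ GM) _; rewrite mulrCA.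
apply: le_trans (ler_norm_sum _ _ _) _; rewrite mulr_sumr; apply: ler_sum => e _.
by apply: le_trans (quad_bound _ HM) _; rewrite le_eqVlt; apply/orP; left; apply/eqP; ring.
Qed.

End walk_op.

Section consistency.
Variables (h : R) (l : seq 'I_n) (b : V) (es : seq V).
Hypotheses (h0 : 0 < h) (l3 : forall i, (2 < count_mem i l)%N) (es0 : es != [::]).

(** [walk_op] of the mollified function, written with the explicit derivatives of
    [smooth_gradient]. *)
Definition smooth_op f : V -> R :=
  walk_op b es (fun i => smooth h (rem i l) (dq i h f))
    (fun i j => smooth h (rem j (rem i l)) (dq j h (dq i h f))).

Let count_rem_ge i j (s : seq 'I_n) m : (m.+1 < count_mem i s)%N ->
  (m < count_mem i (rem j s))%N.
Proof.
rewrite count_rem => lt_m; case: (_ && _) => /=; first by rewrite ltn_subRL add1n.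
by rewrite subn0 ltnW.
Qed.

Let mem_l i : i \in l.
Proof. by rewrite -has_pred1 has_count (leq_trans _ (l3 i)). Qed.

Let mem_l1 i j : j \in rem i l.
Proof.
by rewrite -has_pred1 has_count; apply: (@leq_trans 2) => //; apply: count_rem_ge.
Qed.

Let mem_l2 i j k : k \in rem j (rem i l).
Proof. by rewrite -has_pred1 has_count; apply: count_rem_ge; apply: count_rem_ge. Qed.

(** Three box averages in each direction give derivatives of order three that are
    Lipschitz, with a constant that depends only on [L] and [h]. *)
Lemma smooth_jets L f : 0 <= L -> Lip L f ->
  let M := L * (1 + 2 / h) ^+ 3 in
  let G i := smooth h (rem i l) (dq i h f) in
  let H i j := smooth h (rem j (rem i l)) (dq j h (dq i h f)) in
  let K i j k := smooth h (rem k (rem j (rem i l))) (dq k h (dq j h (dq i h f))) in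
  [/\ gradient (smooth h l f) G, forall i, gradient (G i) (H i) &
      forall i j, gradient (H i j) (K i j)] /\
  [/\ forall i, Lip M (G i), forall i j, Lip M (H i j),
      forall i j k, Lip M (K i j k), forall i j x, `|H i j x| <= M
      & forall i j k x, `|K i j k x| <= M].
Proof.
move=> L0 Lf M G H K.
have q0 : 0 <= 2 / h by rewrite divr_ge0// ltW.
have L1 i := dq_Lip i h0 Lf.
have L2 i j := dq_Lip j h0 (L1 i).
have L3 i j k := dq_Lip k h0 (L2 i j).
have q2 : 0 <= (2 / h) ^+ 2 by rewrite exprn_ge0.
have q3 : 0 <= (2 / h) ^+ 3 by rewrite exprn_ge0.
have qE : (1 + 2 / h) ^+ 3 = 1 + 3 * (2 / h) + 3 * (2 / h) ^+ 2 + (2 / h) ^+ 3.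
  by ring.
have M1 : 2 / h * L <= M by rewrite /M mulrC ler_wpM2l// qE; lra.
have M2 : 2 / h * (2 / h * L) <= M.
  rewrite (_ : 2 / h * _ = L * (2 / h) ^+ 2); last by ring.
  by rewrite ler_wpM2l// qE; lra.
have M3 : 2 / h * (2 / h * (2 / h * L)) <= M.
  rewrite (_ : 2 / h * _ = L * (2 / h) ^+ 3); last by ring.
  by rewrite ler_wpM2l// qE; lra.
have aS s := smooth_average s h0.
split; split.
- exact: smooth_gradient Lf _.
- by move=> i; apply: smooth_gradient (L1 i) _.
- by move=> i j; apply: smooth_gradient (L2 i j) _.
- by move=> i; apply: Lip_le M1 (average_Lip (aS _) (L1 i)).
- by move=> i j; apply: Lip_le M2 (average_Lip (aS _) (L2 i j)).
- by move=> i j k; apply: Lip_le M3 (average_Lip (aS _) (L3 i j k)).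
- move=> i j x; apply: average_bound (aS _) (L2 i j) _ => y.
  apply: le_trans M1; apply: dq_bound h0 _ (L1 i); exact: mulr_ge0.
- move=> i j k x; apply: average_bound (aS _) (L3 i j k) _ => y.
  apply: le_trans M2; apply: dq_bound h0 _ (L2 i j); do 2 apply: mulr_ge0 => //.
Qed.

(** The walk advances a mollified function by [tau * smooth_op f] and moves
    [smooth_op f] itself by [O(tau)], uniformly in all [L]-Lipschitz [f]. *)
Lemma smooth_consistent L : 0 <= L -> exists2 C : R, 0 <= C &
  forall f, Lip L f -> forall (tau : R) x, 0 < tau <= 1 ->
    `|walk b es tau (smooth h l f) x - smooth h l f x - tau * smooth_op f x|
      <= C * (tau * Num.sqrt tau) /\
    `|walk b es tau (smooth_op f) x - smooth_op f x| <= C * tau.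
Proof.
move=> L0; pose M := L * (1 + 2 / h) ^+ 3.
have q0 : 0 <= 2 / h by rewrite divr_ge0// ltW.
have M0 : 0 <= M by rewrite mulr_ge0// exprn_ge0// addr_ge0.
have [C1 C10 h1] := @walk_consistent R n b es es0 M M0.
have [C2 C20 h2] := @walk_lip_time R n b es es0 M M0.
pose w := n%:R * `|b| + \sum_(e <- es) n%:R * (n%:R * `|e| * `|e|).
have w0 : 0 <= w.
  by rewrite addr_ge0 ?mulr_ge0// sumr_ge0// => e _; rewrite !mulr_ge0.
exists (C1 + C2 * w); first by rewrite addr_ge0// mulr_ge0.
move=> f Lf tau x t01.
have [[D1 D2 D3] [G1 H1 K1 H2 K2]] := smooth_jets L0 Lf.
have [r0 r2 tr] := sqrt_tau t01; have t0 : 0 < tau by case/andP: t01.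
split.
  apply: le_trans (h1 _ _ _ D1 D2 G1 H1 H2 tau x t01) _.
  by rewrite ler_wpM2r ?lerDl ?mulr_ge0// ltW.
rewrite /walk fin_avg_walk_op walk_opB.
have HC i j : `|walk b es tau (smooth h (rem j (rem i l)) (dq j h (dq i h f))) x
  - smooth h (rem j (rem i l)) (dq j h (dq i h f)) x| <= C2 * tau.
  exact: (h2 _ _ (D3 i j) (K1 i j) (K2 i j) tau x t01).
have GC i : `|walk b es tau (smooth h (rem i l) (dq i h f)) x
  - smooth h (rem i l) (dq i h f) x| <= C2 * tau.
  apply: (h2 _ _ (D2 i) (H1 i) _ tau x t01) => j y; exact: H2.
apply: le_trans (walk_op_bound _ _ GC HC) _.
by rewrite -/w mulrAC ler_wpM2r ?(ltW t0)// lerDr.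
Qed.

(** The walk commutes with the mollifier and with difference quotients; along the
    discrete evolution the operator therefore evolves by the same walk. *)
Lemma walk_smooth_op tau L f : Lip L f ->
  walk b es tau (smooth_op f) = smooth_op (walk b es tau f).
Proof.
move=> Lf; apply/funext => x; rewrite /smooth_op /walk fin_avg_walk_op.
have aW := fin_avg_is_average (@steps_neq0 _ _ b es es0 tau).
have aS s := smooth_average s h0.
have L1 i := dq_Lip i h0 Lf.
have L2 i j := dq_Lip j h0 (L1 i).
congr (walk_op b es _ _ x).
  apply/funext => i; rewrite (average_comm aW (aS _) (L1 i)).
  by rewrite (average_dq _ _ aW Lf).
apply/funext => i; apply/funext => j.
rewrite (average_comm aW (aS _) (L2 i j)) (average_dq _ _ aW (L1 i)).
by rewrite (average_dq _ _ aW Lf).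
Qed.

End consistency.
End Smoothing.


(** * Comparison of a subsolution with the random walk *)

Section Key.
Context {R : realType} {n : nat}.
Notation V := 'rV[R]_n.
Implicit Types (f : V -> R) (x y z : V) (L M c h : R) (i j : 'I_n).

Definition smooth2 f G (H : 'I_n -> 'I_n -> V -> R) :=
  [/\ gradient f G, forall i, gradient (G i) (H i),
      forall i, continuous (G i) & forall i j, continuous (H i j)].

Lemma gradientD f g G G' a : gradient f G -> gradient g G' ->
  gradient (fun x => f x + a * g x) (fun i x => G i x + a * G' i x).
Proof.
move=> fG gG x i; have d1 := fG x i; have d2 := gG x i.
rewrite (_ : (fun x => f x + a * g x) = f + a \*: g); last exact/funext.
exact: is_derive_eq.
Qed.

Lemma gradient_addc f G c : gradient f G -> gradient (fun x => f x + c) G.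
Proof.
move=> fG x i; have d1 := fG x i.
rewrite (_ : (fun x => f x + c) = f + cst c); last exact/funext.
by apply: is_derive_eq; rewrite addr0.
Qed.

Lemma smooth2D f g G G' H H' a : smooth2 f G H -> smooth2 g G' H' ->
  smooth2 (fun x => f x + a * g x) (fun i x => G i x + a * G' i x)
    (fun i j x => H i j x + a * H' i j x).
Proof.
move=> [f1 f2 f3 f4] [g1 g2 g3 g4]; split.
- exact: gradientD.
- by move=> i; apply: gradientD.
- by move=> i x; apply: cvgD (f3 i x) _; apply: cvgM (g3 i x); apply: cvg_cst.
- by move=> i j x; apply: cvgD (f4 i j x) _; apply: cvgM (g4 i j x); apply: cvg_cst.
Qed.

Lemma smooth2_addc f G H c : smooth2 f G H -> smooth2 (fun x => f x + c) G H.
Proof. by move=> [f1 f2 f3 f4]; split => //; apply: gradient_addc. Qed.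

Definition sqdist x0 x : R := dot (x - x0) (x - x0).

Lemma coord_cvg (k : 'I_1) i : continuous (fun x : V => x k i).
Proof. exact: coord_continuous. Qed.

Lemma smooth2_sqdist x0 : smooth2 (sqdist x0) (fun i x => 2 * (x - x0) 0 i)
  (fun i j _ => 2 * (i == j)%:R).
Proof.
split.
- move=> x i; apply/is_derive_line0.
  apply: (@quadratic_is_derive _ _ _ _ 1) => t.
  rewrite addr0 scale0r addr0 mul1r /sqdist /dot -sumrB (bigD1 i)//= big1.
    rewrite !(e_E, mxE) eqxx addr0 /= mulr1.
    rewrite [X in `|X|](_ : _ = t ^+ 2); last by ring.
    by rewrite ger0_norm// sqr_ge0.
  by move=> j ji; rewrite !(e_E, mxE) (negPf ji) mulr0 addr0 subrr.
- move=> i x j; apply/is_derive_line0.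
  apply: (@quadratic_is_derive _ _ _ _ 0) => t.
  rewrite addr0 scale0r addr0 !(e_E, mxE) mul0r.
  by rewrite [X in `|X|](_ : _ = 0) ?normr0//; ring.
- move=> i x; apply: (@cvgM _ _ (nbhs x)); first exact: cvg_cst.
  have -> : (fun y => (y - x0) 0 i) = (fun y => y 0 i + - x0 0 i).
    by apply/funext => y; rewrite !mxE.
  by rewrite !mxE; apply: cvgD; [exact: coord_cvg|exact: cvg_cst].
- by move=> i j; apply: cst_continuous.
Qed.

Lemma sqdist_continuous x0 : continuous (sqdist x0).
Proof.
have -> : sqdist x0 = fun x => 
      \sum_(i < n) (x 0 i + - x0 0 i) * (x 0 i + - x0 0 i).
  by apply/funext => x; apply: eq_bigr => i _; rewrite !mxE.
apply: continuous_big => [|i _ x]; first exact: add_continuous.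
by apply: (@cvgM _ _ (nbhs x)); apply: cvgD;
  [exact: coord_cvg|exact: cvg_cst|exact: coord_cvg|exact: cvg_cst].
Qed.

Lemma norm_sqdist x0 x : `|x - x0| ^+ 2 <= sqdist x0 x.
Proof.
have sq i : 0 <= (x - x0) 0 i * (x - x0) 0 i by rewrite -expr2 sqr_ge0.
have [->|xx0] := eqVneq (x - x0) 0; first by rewrite normr0 expr0n sumr_ge0.
have /mx_norm_neq0[[a i] /= E] : mx_norm (x - x0) != 0.
  by rewrite -[mx_norm _]/(`|x - x0|) normr_eq0.
rewrite -[`|x - x0|]/(mx_norm (x - x0)) E real_normK ?num_real//.
by rewrite /sqdist /dot (bigD1 i)//= (ord1 a) expr2 lerDl sumr_ge0.
Qed.

Variables (b : V) (es : seq V) (l : seq 'I_n).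
Hypotheses (l3 : forall i, (2 < count_mem i l)%N) (es0 : es != [::]).

Lemma walk_op_axpy G H G' H' a x :
  walk_op b es (fun i y => G i y + a * G' i y)
    (fun i j y => H i j y + a * H' i j y) x =
  walk_op b es G H x + a * walk_op b es G' H' x.
Proof.
rewrite /walk_op /lin /quad mulrDr addrACA !mulr_sumr -!big_split; congr (_ + _).
  by apply: eq_bigr => i _ /=; rewrite mulrDl mulrA.
apply: eq_bigr => e _ /=; rewrite mulr_sumr -big_split; apply: eq_bigr => i _ /=.
rewrite mulrA -mulrDl mulr_sumr -big_split; congr (_ * _).
by apply: eq_bigr => j _ /=; rewrite mulrDl mulrA.
Qed.

Lemma walk_op_sqdist x0 x (r : R) : `|x - x0| <= r ->
  walk_op b es (fun i x => 2 * (x - x0) 0 i) (fun i j _ => 2 * (i == j)%:R) x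
  <= (2 * r + 2) * (n%:R * `|b| + \sum_(e <- es) n%:R * (n%:R * `|e| * `|e|)).
Proof.
move=> xr; have r0 := le_trans (normr_ge0 _) xr.
apply: le_trans (ler_norm _) _; apply: walk_op_bound => [i|i j].
  by rewrite normrM ger0_norm//; have := coord_le_norm (x - x0) 0 i; lra.
by rewrite normrM ger0_norm// normr_nat; case: (i == j) => /=; lra.
Qed.

(** Viscosity subsolutions of [walk_op b es >= c] on [D].  Test functions that are
    smooth and dominate [f] everywhere are enough, since the only ones used are
    evolved mollifications of [f] plus quadratic polynomials. *)
Definition subsol (D : set V) c f :=
  forall x phi G H, D x -> smooth2 phi G H -> (forall y, f y <= phi y) ->
    f x = phi x -> c <= walk_op b es G H x.

Definition semiconvex M f :=
  forall x y, 2 * f x - M * `|y| ^+ 2 <= f (x + y) + f (x - y).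

Lemma walkE tau f x : walk b es tau f x =
  (\sum_(e <- es) (f (x + (tau *: b + step_size es tau *: e))
    + f (x + (tau *: b - step_size es tau *: e))) / 2) / (size es)%:R.
Proof.
apply/eqP; rewrite -subr_eq0 -normr_le0.
by apply: walk_error => // e _; rewrite subrr normr0.
Qed.

(** Semiconvexity bounds the symmetric second differences from below and the
    Lipschitz constant bounds the drift, so one step of the walk loses at most
    [O(tau)]. *)
Lemma walk_ge L M : 0 <= L -> 0 <= M -> exists2 C : R, 0 <= C & forall f,
  Lip L f -> semiconvex M f -> forall (tau : R) x, 0 <= tau ->
  f x <= walk b es tau f x + C * tau.
Proof.
move=> L0 M0; pose w := \sum_(e <- es) `|e| ^+ 2.
have w0 : 0 <= w by rewrite sumr_ge0// => e _; rewrite exprn_ge0.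
pose C := L * `|b| + M * (size es)%:R * w.
have CE : C = L * `|b| + M * (size es)%:R * w by [].
exists C; first by rewrite addr_ge0 ?mulr_ge0// ler0n.
clearbody C; move=> f Lf Mf tau x t0; rewrite walkE -lerBlDr ler_pdivlMr ?size_gt0R//.
rewrite -sum_cst_seq big_seq [leRHS]big_seq; apply: ler_sum => e ees.
rewrite CE; have ew : `|e| ^+ 2 <= w.
  by rewrite /w (big_rem e)//= lerDl sumr_ge0// => e' _; rewrite exprn_ge0.
have := Mf (x + tau *: b) (step_size es tau *: e); rewrite -!addrA.
have h1 : `|step_size es tau *: e| ^+ 2 <= 2 * (size es)%:R * tau * w.
  rewrite normrZ exprMn real_normK ?num_real// sqr_sqrtr ?mulr_ge0 ?ler0n//.
  by rewrite ler_wpM2l ?mulr_ge0 ?ler0n.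
have h2 : f x <= f (x + tau *: b) + L * `|b| * tau.
  have := Lf x (x + tau *: b); rewrite opprD addNKr normrN normrZ (ger0_norm t0).
  by rewrite ler_norml => /andP[_]; lra.
have := ler_wpM2l M0 h1.
set F := f (x + tau *: b) in h2 *; lra.
Qed.

(** Heuristically, a subsolution of [Op f >= c] lies below its own evolution
    under the semigroup of [Op]: [f + c * t <= exp(t Op) f].  The semigroup is replaced
    by [N] steps of the walk applied to a mollification of [f], which is smooth
    and hence an admissible test function.

    The claim [Phi k <= beta] is proved by induction on the number [k] of steps,
    by the maximum principle.  The barrier [A * (k * tau) * |x - x0|^2] forces a
    violation to occur inside the ball: outside, [walk_ge] already gives the
    bound, and the loss it allows is also proportional to [k * tau].  At a
    maximum the evolved function plus the barrier touches [f] from above, so the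
    operator is at least [c - eta / 2] there; by consistency the last step has
    then raised the evolved function by at least [tau * (c - eta)], and [Phi]
    was already too large one step before.

    All thresholds depend on [f], [x0] and [c] only through [L], [M] and [Cb];
    the inequality can therefore be averaged over [x0]. *)
Lemma key_inequality L M (r Cb eta : R) : 0 <= L -> 0 <= M -> 0 < r ->
  0 <= Cb -> 0 < eta -> exists2 t0 : R, 0 < t0 & forall t h : R,
  0 < t <= t0 -> 0 < h -> exists2 tau0 : R, 0 < tau0 & forall N : nat,
  (0 < N)%N -> t / N%:R <= tau0 -> forall f x0 c, Lip L f -> semiconvex M f ->
  `|c| <= Cb -> subsol [set x | `|x - x0| < r] c f ->
  f x0 + (c - eta) * t <=
    iter N (walk b es (t / N%:R)) (smooth h l f) x0 + L * (h *+ size l).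
Proof.
move=> L0 M0 r0 Cb0 eta0.
have [K K0 hK] := walk_ge L0 M0.
pose w := n%:R * `|b| + \sum_(e <- es) n%:R * (n%:R * `|e| * `|e|).
have w0 : 0 <= w.
  by rewrite addr_ge0 ?mulr_ge0// sumr_ge0// => e _; rewrite !mulr_ge0.
pose A := (K + Cb) / r ^+ 2; pose C2 := (2 * r + 2) * w.
have A0 : 0 <= A by rewrite divr_ge0 ?addr_ge0// exprn_ge0// ltW.
have C20 : 0 <= C2 by rewrite mulr_ge0// addr_ge0// mulr_ge0// ltW.
have AC0 := mulr_ge0 A0 C20.
have AC : 0 < 2 * (A * C2 + 1) by lra.
exists (eta / (2 * (A * C2 + 1))); first by rewrite divr_gt0.
move=> t h /andP[t0 tt0] h0.
have ACt : A * C2 * t <= eta / 2.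
  rewrite ler_pdivlMr// in tt0.
  have := mulr_ge0 AC0 (ltW t0).
  lra.
have [C C0 hC] := smooth_consistent b h0 l3 es0 L0.
pose s := Num.min 1 (eta / (4 * (C + 1))).
have s0 : 0 < s by rewrite lt_min ltr01 divr_gt0// mulr_gt0// ltr_wpDl.
exists (s ^+ 2); first by rewrite exprn_gt0.
move=> N N0 Ns f x0 c Lf Mf cCb fsub.
set tau := t / N%:R in Ns *.
have NR : 0 < N%:R :> R by rewrite ltr0n.
have tau_gt0 : 0 < tau by rewrite divr_gt0.
have tau_ge0 := ltW tau_gt0.
have rs : Num.sqrt tau <= s.
  by rewrite -(ger0_norm (ltW s0)) -sqrtr_sqr ler_sqrt// ?exprn_ge0 ?ltW.
have s1 : s <= 1 by rewrite ge_min lexx.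
have tau01 : 0 < tau <= 1.
  by rewrite tau_gt0 (le_trans Ns)// exprn_ile1// ltW.
have [rt0 rt2 rt1] := sqrt_tau tau01.
have Ceta : C * (tau + Num.sqrt tau) <= eta / 2.
  have sC : s * (4 * (C + 1)) <= eta.
    by rewrite -ler_pdivlMr ?mulr_gt0 ?ltr_wpDl// ge_min lexx orbT.
  have : C * (tau + Num.sqrt tau) <= C * (2 * s) by rewrite ler_wpM2l//; lra.
  have := ltW s0; nra.
pose W := walk b es tau; pose Vk (k : nat) := iter k W f.
pose U k := iter k W (smooth h l f); pose beta := L * (h *+ size l).
have aW := fin_avg_is_average (@steps_neq0 _ _ b es es0 tau).
have aS := smooth_average l h0.
have VL k : Lip L (Vk k) by apply: average_Lip (average_iter k aW) Lf.
have UE k : U k = smooth h l (Vk k).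
  by rewrite -(average_comm (average_iter k aW) aS Lf).
have UL k : Lip L (U k) by rewrite UE; apply: average_Lip aS (VL k).
have beta0 : 0 <= beta by rewrite mulr_ge0// mulrn_wge0// ltW.
have fU k x : f x <= U k x + (beta + K * (k%:R * tau)).
  elim: k x => [|k IH] x.
    rewrite mul0r mulr0 addr0 /U/=.
    have := average_near x aS L0 Lf; rewrite ler_norml -/beta => /andP[+ _]; lra.
  apply: le_trans (hK f Lf Mf tau x tau_ge0) _.
  have : W f x <= W (U k) x + (beta + K * (k%:R * tau)).
    by apply: fin_avg_le => [|z _]; [exact: steps_neq0|exact: IH].
  rewrite -natr1 -[walk b es tau f x]/(W f x) -[U k.+1 x]/(W (U k) x).
  rewrite mulrDl mul1r mulrDr; lra.
pose Phi k x := f x - U k x + (c - eta) * (k%:R * tau)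
   - A * (k%:R * tau) * sqdist x0 x.
suff Phib k : (k <= N)%N -> forall x, Phi k x <= beta.
  have := Phib N (leqnn N) x0; rewrite /Phi -/beta.
  have -> : N%:R * tau = t by rewrite /tau mulrC divfK// gt_eqF.
  have -> : sqdist x0 x0 = 0.
    by rewrite /sqdist subrr /dot big1// => i _; rewrite mxE mul0r.
  by rewrite /U -/W; lra.
elim: k => [_ x|k IH kN].
  have := fU 0%N x; rewrite /Phi !mul0r !mulr0 mul0r; lra.
have {}IH := IH (ltnW kN).
set T := k.+1%:R * tau.
have T0 : 0 <= T by rewrite mulr_ge0.
have Tt : T <= t by rewrite /T /tau mulrA ler_pdivrMr// mulrC ler_wpM2l ?ler_nat// ltW.
(* the barrier dominates the worst loss allowed by [fU] outside the ball *)
have out x : r <= `|x - x0| -> Phi k.+1 x <= beta.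
  move=> rx; have := fU k.+1 x; rewrite /Phi -/T.
  have Aq : K + Cb <= A * sqdist x0 x.
    have -> : K + Cb = A * r ^+ 2 by rewrite divfK// expf_neq0// gt_eqF.
    rewrite ler_wpM2l// (le_trans _ (norm_sqdist _ _))//.
    by rewrite ler_pXn2r// nnegrE// ltW.
  have := ler_wpM2r T0 Aq.
  have : c * T <= Cb * T by rewrite ler_wpM2r// (le_trans (ler_norm _)).
  have : 0 <= eta * T by rewrite mulr_ge0// ltW.
  lra.
move=> x'; rewrite leNgt; apply/negP => Phix'.
pose B := [set x | `|x - x0| <= r].
have cU := @lipschitz_continuous _ _ _ _ (UL k.+1).
have cf := @lipschitz_continuous _ _ _ _ Lf.
have cPhi : continuous (Phi k.+1).
  rewrite /Phi => x; apply: (@cvgB _ R^o _ (nbhs x)).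
    apply: (@cvgD _ R^o _ (nbhs x)); last exact: cvg_cst.
    by apply: (@cvgB _ R^o _ (nbhs x)); [exact: cf|exact: cU].
  by apply: (@cvgM _ _ (nbhs x)); [exact: cvg_cst|exact: sqdist_continuous].
have cB : compact B.
  apply: bounded_closed_compact.
    exists (`|x0| + r); split; first exact: num_real.
    move=> m mr x Bx; apply: le_trans (ltW mr).
    by rewrite -[x](subrK x0) addrC (le_trans (ler_normD _ _))// lerD2l.
  rewrite (_ : B = (fun x => `|x - x0|) @^-1` [set y | y <= r])//.
  apply: closed_comp; last exact: closed_le.
  move=> x _; apply: (@lipschitz_continuous _ _ _ 1) => u v.
  rewrite mul1r (le_trans (ler_dist_dist _ _))//.
  by rewrite opprB addrA subrK.
have B0 : B !=set0 by exists x0; rewrite /B/= subrr normr0 ltW.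
have [x1 Bx1 x1max] := EVT_max_rV B0 cB (continuous_subspaceT cPhi).
rewrite inE in Bx1.
have xB x : Phi k.+1 x <= Phi k.+1 x1 \/ Phi k.+1 x <= beta.
  have [xr|rx] := leP `|x - x0| r; [left|right].
    by apply: x1max; rewrite inE.
  by apply: out; apply: ltW.
have x1b : beta < Phi k.+1 x1.
  by case: (xB x') => ?; [apply: lt_le_trans Phix' _|lra].
have x1r : `|x1 - x0| < r.
  by rewrite ltNge; apply/negP => /out; lra.
have x1M x : Phi k.+1 x <= Phi k.+1 x1 by case: (xB x) => // ?; lra.
(* [U k.+1] plus the barrier plus a constant touches [f] from above at [x1] *)
have [[D1 D2 D3] [G1 H1 K1 H2 K2]] := smooth_jets h0 l3 L0 (VL k.+1).
have S1 := @smooth2_sqdist x0.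
have S0 : smooth2 _ _ _ := And4 D1 D2
  (fun i => lipschitz_continuous (G1 i))
  (fun i j => lipschitz_continuous (H1 i j)).
have := smooth2_addc (f x1 - U k.+1 x1 - A * T * sqdist x0 x1)
  (smooth2D (A * T) S0 S1).
move/(fsub x1) => /(_ x1r) touch.
have {}touch : c <= smooth_op h l b es (Vk k.+1) x1 + A * T * walk_op b es
    (fun i x => 2 * (x - x0) 0 i) (fun i j _ => 2 * (i == j)%:R) x1.
  rewrite -walk_op_axpy; apply: touch; last by rewrite -UE; lra.
  move=> y; rewrite -UE; have := x1M y; rewrite /Phi -/T; lra.
have wq := walk_op_sqdist Bx1.
have wT : A * T * walk_op b es (fun i x => 2 * (x - x0) 0 i)
    (fun i j _ => 2 * (i == j)%:R) x1 <= eta / 2.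
  apply: le_trans ACt; apply: (@le_trans _ _ (A * T * C2)).
    exact: ler_wpM2l (mulr_ge0 A0 T0) _ _ wq.
  by rewrite mulrAC; exact: ler_wpM2l AC0 _ _ Tt.
have [hc1 hc2] := hC _ (VL k) tau x1 tau01.
have := walk_smooth_op l b h0 es0 tau (VL k).
move/(congr1 (fun F => F x1)) => E.
rewrite -[walk b es tau (Vk k)]/(Vk k.+1) in E.
have := IH x1; have := x1b; rewrite /Phi -/T.
rewrite E in hc2; rewrite -UE in hc1; rewrite -[walk _ _ _ (U k)]/(U k.+1) in hc1.
have -> : T = k%:R * tau + tau by rewrite /T -natr1 mulrDl mul1r.
move: hc1 hc2; rewrite !ler_norml => /andP[hc1 _] /andP[_ hc2] h1 h2.
have sq0 : 0 <= sqdist x0 x1 by apply: le_trans (norm_sqdist _ _); rewrite exprn_ge0.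
have := mulr_ge0 (mulr_ge0 A0 tau_ge0) sq0.
have h3 : c - eta <= smooth_op h l b es (Vk k) x1 - C * Num.sqrt tau by lra.
have := ler_wpM2l tau_ge0 h3.
lra.
Qed.

End Key.


(** * Mollified subsolutions are classical subsolutions *)

Section Mollify.
Context {R : realType} {n : nat}.
Notation V := 'rV[R]_n.
Implicit Types (f : V -> R) (x y z : V) (L M c h : R) (i j : 'I_n).

Variables (b : V) (es : seq V) (l : seq 'I_n).
Hypotheses (l3 : forall i, (2 < count_mem i l)%N) (es0 : es != [::]).

(** For a fixed mollification the evolution is as slow as its generator: [t] times
    the operator at the starting point, up to [o(t)]. *)
Lemma iter_walk_le h L : 0 < h -> 0 <= L -> exists2 C : R, 0 <= C &
  forall f, Lip L f -> forall (tau : R) x, 0 < tau <= 1 -> forall N,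
  iter N (walk b es tau) (smooth h l f) x <= smooth h l f x +
    N%:R * tau * (smooth_op h l b es f x + C * (N%:R * tau) + C * Num.sqrt tau).
Proof.
move=> h0 L0; have [C C0 hC] := smooth_consistent b h0 l3 es0 L0.
exists C => // f Lf tau x t01 N.
have t0 : 0 < tau by case/andP: t01.
pose S := smooth_op h l b es; pose Vk k := iter k (walk b es tau) f.
have aW := fin_avg_is_average (@steps_neq0 _ _ b es es0 tau).
have VL k : Lip L (Vk k) by apply: average_Lip (average_iter k aW) Lf.
have UE k : iter k (walk b es tau) (smooth h l f) = smooth h l (Vk k).
  exact: (average_comm (average_iter k aW) (smooth_average l h0) Lf).
have SV k : S (Vk k) x <= S f x + C * (k%:R * tau).
  elim: k => [|k IH]; first by rewrite mul0r mulr0 addr0.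
  have := (hC _ (VL k) tau x t01).2.
  rewrite (walk_smooth_op l b h0 es0 tau (VL k)).
  rewrite -[walk b es tau (Vk k)]/(Vk k.+1) ler_norml => /andP[_].
  by rewrite -/S -natr1 mulrDl mul1r mulrDr; lra.
suff H k : (k <= N)%N -> iter k (walk b es tau) (smooth h l f) x
    <= smooth h l f x + k%:R * (tau * (S f x + C * (N%:R * tau)
         + C * Num.sqrt tau)).
  by have := H N (leqnn N); rewrite mulrA.
elim: k => [_|k IH kN]; first by rewrite mul0r addr0.
have := IH (ltnW kN); have := (hC _ (VL k) tau x t01).1.
have h1 : S (Vk k) x <= S f x + C * (N%:R * tau).
  apply: le_trans (SV k) _; rewrite lerD2l ler_wpM2l// ler_wpM2r ?ler_nat ?(ltW t0)//.
  exact: ltnW.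
have := ler_wpM2l (ltW t0) h1.
rewrite iterS !UE -/(S (Vk k) x) ler_norml => {}h1 /andP[_ h2] h3.
rewrite -natr1 mulrDl mul1r; move: h1 h2 h3.
rewrite -/S; set s1 := S _ x; set s2 := S f x; set q := Num.sqrt tau.
by rewrite !mulrDr; lra.
Qed.

(** [key_inequality] holds at every point near [x1], with [c] replaced by the
    local value of [c - a * f].  Averaging it with the mollifier, which commutes
    with the walk, gives [v + (c - a * v) * t <= v + smooth_op * t + o(t)] at
    [x1] for the mollification [v] of [f]; dividing by [t] concludes. *)
Lemma mollify_subsolution L M h r a c f x1 :
  0 <= L -> 0 <= M -> 0 < h -> h *+ size l < r -> Lip L f -> semiconvex M f ->
  (forall x phi G H, `|x - x1| < r -> smooth2 phi G H ->
    (forall y, f y <= phi y) -> f x = phi x ->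
    c <= a * f x + walk_op b es G H x) ->
  c <= a * smooth h l f x1 + smooth_op h l b es f x1.
Proof.
move=> L0 M0 h0 hr Lf Mf fsub.
set rho := h *+ size l in hr *; set v := smooth h l f; set S := smooth_op _ _ _ _ f.
have rho0 : 0 <= rho by rewrite mulrn_wge0// ltW.
apply/ler_addgt0Pr => e6 e60.
have [e e0 ->] : exists2 e : R, 0 < e & e6 = 6 * e.
  by exists (e6 / 6); [rewrite divr_gt0|rewrite mulrC divfK].
have aL : 0 <= `|a| * L by rewrite mulr_ge0.
pose r' := Num.min (r - rho) (e / (`|a| * L + 1)).
have r'0 : 0 < r' by rewrite lt_min subr_gt0 hr divr_gt0// ltr_wpDl.
have r'r : r' <= r - rho by rewrite ge_min lexx.
have aLr : `|a| * L * r' <= e.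
  have : r' * (`|a| * L + 1) <= e.
    by rewrite -ler_pdivlMr ?ltr_wpDl// ge_min lexx orbT.
  by rewrite mulrDr mulr1 mulrC; lra.
(* a bound for all the local right-hand sides [c - a * f x - |a| * L * r'] *)
pose Cb := `|c| + `|a| * (`|f x1| + L * rho) + `|a| * L * r'.
have Cb0 : 0 <= Cb.
  apply: addr_ge0; last exact: mulr_ge0 aL (ltW r'0).
  by apply: addr_ge0 => //; apply: mulr_ge0 => //; apply: addr_ge0 => //; apply: mulr_ge0.
have [t0 t00 Ht] := @key_inequality _ _ b es l l3 es0 L M r' Cb e L0 M0 r'0 Cb0 e0.
have [C C0 hC] := iter_walk_le h0 L0.
pose t := Num.min t0 (e / (C + 1)).
have t_gt0 : 0 < t by rewrite lt_min t00 divr_gt0// ltr_wpDl.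
have Ct : C * t <= e.
  have : t * (C + 1) <= e.
    by rewrite -ler_pdivlMr ?ltr_wpDl// ge_min lexx orbT.
  by rewrite mulrDr mulr1 mulrC; lra.
have tt0 : 0 < t <= t0 by rewrite t_gt0 ge_min lexx.
(* the auxiliary mollification scale [d] must be negligible compared with [t] *)
pose K := L * (size l)%:R + 1.
have K0 : 0 < K by rewrite ltr_wpDl// mulr_ge0// ler0n.
pose d := e * t / K.
have d0 : 0 < d by rewrite divr_gt0// mulr_gt0.
have dE : L * (d *+ size l) <= e * t.
  have E : d * K = e * t by rewrite divfK// gt_eqF.
  rewrite -mulr_natr mulrCA -E ler_wpM2l ?(ltW d0)// /K; lra.
have [tau0 tau00 {}Ht] := Ht t d tt0 d0.
pose s := Num.min 1 (e / (C + 1)).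
have s0 : 0 < s by rewrite lt_min ltr01 divr_gt0// ltr_wpDl.
have s1 : s <= 1 by rewrite ge_min lexx.
have Cs : C * s <= e.
  have : s * (C + 1) <= e.
    by rewrite -ler_pdivlMr ?ltr_wpDl// ge_min lexx orbT.
  by rewrite mulrDr mulr1 mulrC; lra.
pose tm := Num.min tau0 (s ^+ 2).
have tm0 : 0 < tm by rewrite lt_min tau00 exprn_gt0.
pose N := (Num.truncn (t / tm)).+1.
have N0 : 0 < N%:R :> R by rewrite ltr0n.
have Nt : t / N%:R <= tm.
  by rewrite ler_pdivrMr// mulrC -ler_pdivrMr// ltW// truncnS_gt.
have [Nt1 Nt2] : t / N%:R <= tau0 /\ t / N%:R <= s ^+ 2.
  by move: Nt; rewrite le_min => /andP[].
set tau := t / N%:R in Nt1 Nt2.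
have tau_gt0 : 0 < tau by rewrite divr_gt0.
have tau01 : 0 < tau <= 1.
  by rewrite tau_gt0 (le_trans Nt2)// exprn_ile1// ltW.
have Nt_ : N%:R * tau = t by rewrite mulrC divfK// gt_eqF.
have sq : C * Num.sqrt tau <= e.
  apply: le_trans Cs; rewrite ler_wpM2l//.
  by rewrite -(ger0_norm (ltW s0)) -sqrtr_sqr ler_sqrt// exprn_ge0 ?(ltW s0).
pose P := iter N (walk b es tau).
pose ct := (c - `|a| * L * r' - e) * t.
have keyx x : `|x - x1| <= rho ->
    (1 - a * t) * f x + 0 * f x <= P (smooth d l f) x + (e * t - ct).
  move=> xr; pose cx := c - a * f x - `|a| * L * r'.
  have cxb : `|cx| <= Cb.
    apply: le_trans (ler_normB _ _) _; apply: lerD; last first.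
      by rewrite ger0_norm//; exact: mulr_ge0 aL (ltW r'0).
    apply: le_trans (ler_normB _ _) _; rewrite lerD2l normrM ler_wpM2l//.
    have := Lf x x1; have := ler_wpM2l L0 xr.
    by have := ler_normB (f x - f x1) (- f x1); rewrite opprK subrK normrN; lra.
  have xsub : subsol b es [set y | `|y - x| < r'] cx f.
    move=> y phi G H /= yx S2 fphi fy.
    have yr : `|y - x1| < r.
      by have := ler_normD (y - x) (x - x1); rewrite addrA subrK; lra.
    have := fsub y phi G H yr S2 fphi fy.
    have h1 : a * (f y - f x) <= `|a| * L * r'.
      apply: le_trans (ler_norm _) _; rewrite normrM -mulrA ler_wpM2l//.
      by apply: le_trans (Lf _ _) _; rewrite ler_wpM2l// ltW.
    by move: h1; rewrite mulrBr /cx; lra.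
  have := Ht N isT Nt1 f x cx Lf Mf cxb xsub.
  by rewrite -/tau -/(P _) /cx /ct; move: dE; rewrite !mulrBl; lra.
have aW := fin_avg_is_average (@steps_neq0 _ _ b es es0 tau).
have aP : average _ P := average_iter N aW.
have aT := smooth_average l h0; have ad := smooth_average l d0.
have PL : Lip L (P (smooth d l f)) := average_Lip aP (average_Lip ad Lf).
have := average_le aT (Lip_lin (1 - a * t) 0 Lf Lf) PL keyx.
rewrite (average_lin _ _ aT Lf Lf) mul0r addr0 -/v.
rewrite -(average_comm aP aT (average_Lip ad Lf)) -(average_comm ad aT Lf) -/v.
have vL : Lip L v := average_Lip aT Lf.
have h1 : P (smooth d l v) x1 <= P v x1 + e * t.
  apply: (average_le aP (average_Lip ad vL) vL) => y _.
  have := average_near y ad L0 vL; rewrite ler_norml => /andP[_]; lra.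
have h2 := hC f Lf tau x1 tau01 N.
rewrite -/(P _) -/v -/S Nt_ in h2.
move=> h3; have {h2} : P v x1 <= v x1 + t * (S x1 + 2 * e).
  by apply: le_trans h2 _; rewrite lerD2l ler_wpM2l ?(ltW t_gt0)//; lra.
move=> h2; rewrite -(ler_pM2l t_gt0).
have := ler_wpM2l (ltW t_gt0) aLr.
move: h1 h2 h3; rewrite /ct; lra.
Qed.

End Mollify.


(** * Linear algebra of jets *)

Section JetAlgebra.
Context {R : realType} {n : nat}.
Notation V := 'rV[R]_n.
Implicit Types (x y z : V) (c : R) (i j : 'I_n) (A E : 'M[R]_n) (J K : jet R n).

Lemma dotC x y : dot x y = dot y x.
Proof. by apply: eq_bigr => i _; rewrite mulrC. Qed.

Lemma dotDl x y z : dot (x + y) z = dot x z + dot y z.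
Proof. by rewrite -big_split; apply: eq_bigr => i _; rewrite mxE mulrDl. Qed.

Lemma dotZl c x z : dot (c *: x) z = c * dot x z.
Proof. by rewrite mulr_sumr; apply: eq_bigr => i _; rewrite mxE mulrA. Qed.

Lemma dotDr x y z : dot x (y + z) = dot x y + dot x z.
Proof. by rewrite dotC dotDl ![dot _ x]dotC. Qed.

Lemma dotZr c x z : dot x (c *: z) = c * dot x z.
Proof. by rewrite dotC dotZl dotC. Qed.

Lemma dot_ge0 x : 0 <= dot x x.
Proof. by apply: sumr_ge0 => i _; rewrite -expr2 sqr_ge0. Qed.

Lemma dot_e x i : dot x (e_ i) = x 0 i.
Proof.
rewrite /dot (bigD1 i)//= e_E eqxx mulr1 big1 ?addr0// => j ji.
by rewrite e_E (negPf ji) mulr0.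
Qed.

Lemma e_mul E i j : (e_ i *m E) 0 j = E i j.
Proof. by rewrite -rowE mxE. Qed.

Lemma dot_mx x y : dot x y = (x *m y^T) 0 0.
Proof. by rewrite mxE; apply: eq_bigr => i _; rewrite mxE. Qed.

Lemma dot_sym E x y : E^T = E -> dot (x *m E) y = dot (y *m E) x.
Proof.
move=> ET; rewrite !dot_mx.
have -> : x *m E *m y^T = (y *m E *m x^T)^T by rewrite !trmx_mul trmxK ET mulmxA.
by rewrite mxE.
Qed.

Lemma psd_shift E x i c : psd E ->
  0 <= dot (x *m E) x + 2 * c * (x *m E) 0 i + c ^+ 2 * E i i.
Proof.
move=> [ET /(_ (x + c *: e_ i))]; rewrite mulmxDl -scalemxAl !dotDl !dotDr.
rewrite !dotZl !dotZr (dot_sym (e_ i) x ET) !dot_e e_mul; lra.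
Qed.

Lemma psd_diag E i : psd E -> 0 <= E i i.
Proof.
move=> [_ /(_ (e_ i))]; by rewrite dot_e e_mul.
Qed.

(** Otherwise the quadratic form would be affine and nonconstant along [e_ i],
    hence negative somewhere. *)
Lemma psd_null_row E i j : psd E -> E i i = 0 -> E i j = 0.
Proof.
move=> Ep E0; apply/eqP; rewrite -(inj_eq (@oppr_inj R)) oppr0.
have [ET _] := Ep; have -> : E i j = E j i by rewrite -[in LHS]ET mxE.
rewrite oppr_eq0; apply/negPn/negP => Eji.
have := psd_shift (e_ j) i (- ((E j j + 1) / (2 * E j i))) Ep.
rewrite E0 mulr0 addr0 dot_e !e_mul.
suff -> : 2 * - ((E j j + 1) / (2 * E j i)) * E j i = - (E j j + 1) by lra.
by field.
Qed.

(** Cholesky elimination: subtracting [e^T *m e], where [e] is a row divided by the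
    square root of its diagonal entry, clears one row and keeps the matrix
    positive semidefinite.  It turns the coefficient matrix of an operator into
    the steps of a random walk, without diagonalization. *)
Lemma psd_decomposition E : psd E ->
  exists es : seq V, E = \sum_(e <- es) e^T *m e.
Proof.
suff H m F : psd F -> (forall i j, (m <= i)%N -> F i j = 0) ->
    exists es : seq V, F = \sum_(e <- es) e^T *m e.
  by move=> Ep; apply: (H n E Ep) => i j; rewrite leqNgt ltn_ord.
elim: m F => [|m IH] F Fp F0.
  by exists [::]; rewrite big_nil; apply/matrixP => i j; rewrite mxE F0.
have [nm|mn] := leqP n m.
  by apply: IH => // i j mi; have := leq_trans nm mi; rewrite leqNgt ltn_ord.
pose i := Ordinal mn.
have [Fi|Fi] := eqVneq (F i i) 0.
  apply: IH => // k j; rewrite leq_eqVlt => /orP[/eqP mk|]; last exact: F0.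
  have -> : k = i by apply: val_inj; rewrite /= mk.
  exact: psd_null_row.
have d0 : 0 < F i i by rewrite lt_neqAle eq_sym Fi psd_diag.
have [FT FQ] := Fp.
pose e : V := (Num.sqrt (F i i))^-1 *: row i F.
have eE k j : (e^T *m e) k j = F i k * F i j / F i i.
  rewrite mxE big_ord1 !mxE mulrACA -invfM -expr2 sqr_sqrtr ?ltW//.
  by rewrite mulrC.
have subE M k j : (F - M) k j = F k j - M k j by rewrite !mxE.
have [||es Ees] := IH (F - e^T *m e).
- split=> [|x].
    by rewrite linearB/= FT trmx_mul trmxK.
  have -> : dot (x *m (F - e^T *m e)) x
      = dot (x *m F) x - ((x *m F) 0 i) ^+ 2 / F i i.
    rewrite mulmxBr dotDl -[- (x *m _)]scaleN1r dotZl mulN1r; congr (_ - _).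
    have xe : (x *m e^T) 0 0 = (x *m F) 0 i / Num.sqrt (F i i).
      rewrite -dot_mx dotZr mulrC; congr (_ / _).
      rewrite /dot mxE; apply: eq_bigr => k _; rewrite mxE.
      by rewrite -[in LHS]FT mxE.
    rewrite mulmxA dot_mx -mulmxA mxE big_ord1 xe.
    rewrite [(e *m x^T) 0 0](_ : _ = (x *m e^T) 0 0).
      by rewrite xe -expr2 expr_div_n sqr_sqrtr// ltW.
    by rewrite -!dot_mx dotC.
  have := psd_shift x i (- ((x *m F) 0 i / F i i)) Fp.
  set q := (x *m F) 0 i; set Q := dot _ x.
  suff -> : Q + 2 * - (q / F i i) * q + (- (q / F i i)) ^+ 2 * F i i
     = Q - q ^+ 2 / F i i by [].
  by field.
- move=> k j; rewrite leq_eqVlt => /orP[/eqP mk|mk].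
    have -> : k = i by apply: val_inj; rewrite /= mk.
    by rewrite subE eE mulrAC mulfV// mul1r subrr.
  rewrite subE eE F0//.
  have -> : F i k = F k i by rewrite -[in LHS]FT mxE.
  by rewrite F0// !mul0r subrr.
- by exists (e :: es); rewrite big_cons -Ees addrC subrK.
Qed.

Lemma trace_decomposition E A (es : seq V) : E = \sum_(e <- es) e^T *m e ->
  \tr (E *m A) = \sum_(e <- es) dot (e *m A) e.
Proof.
move=> ->; rewrite mulmx_suml raddf_sum; apply: eq_bigr => e _.
by rewrite /= -mulmxA mxtrace_mulC /mxtrace big_ord1 dot_mx.
Qed.

Lemma trace_psd_ge0 E A : psd E -> psd A -> 0 <= \tr (E *m A).
Proof.
move=> /psd_decomposition[es Ees] [_ Ap]; rewrite (trace_decomposition A Ees).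
by apply: sumr_ge0 => e _; apply: Ap.
Qed.

Lemma psd_decomposition_neq0 E : psd E -> exists2 es : seq V, es != [::] &
  forall A, \tr (E *m A) = \sum_(e <- es) dot (e *m A) e.
Proof.
move=> /psd_decomposition[es Ees]; exists (0 :: es) => // A.
by apply: trace_decomposition; rewrite big_cons trmx0 mul0mx add0r.
Qed.

Lemma quad_dot H (x e : V) :
  quad H x e = dot (e *m \matrix_(i, j) H i j x) e.
Proof.
rewrite /quad /dot (eq_bigr (fun i => \sum_j H i j x * e 0 j * e 0 i)).
  rewrite exchange_big; apply: eq_bigr => j _; rewrite mxE mulr_suml.
  by apply: eq_bigr => i _; rewrite mxE; ring.
by move=> i _; rewrite mulr_suml.
Qed.

(** The pairing with a coefficient jet is a zero-order term plus the generator of a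
    random walk whose drift and steps are read off the coefficients. *)
Lemma jinner_walk_op J (es : seq V) (r : R) G H x :
  (forall A, \tr (J.2 *m A) = \sum_(e <- es) dot (e *m A) e) ->
  jinner J (r, \row_i G i x, \matrix_(i, j) H i j x)
  = J.1.1 * r + walk_op J.1.2 es G H x.
Proof.
move=> JE; rewrite /jinner/= JE /walk_op addrA; congr (_ + _ + _).
  by apply: eq_bigr => i _; rewrite mxE mulrC.
by apply: eq_bigr => e _; rewrite quad_dot.
Qed.

Lemma jinnerD J K K' : jinner J (K + K') = jinner J K + jinner J K'.
Proof.
rewrite /jinner/= mulrDr dotDr mulmxDr linearD/=.
by ring.
Qed.

Lemma jinnerZ J c K : jinner J (c *: K) = c * jinner J K.
Proof.
rewrite /jinner/= dotZr -scalemxAr linearZ/= !mulrDr.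
by congr (_ + _ + _); rewrite mulrCA.
Qed.

Lemma trace_sym E A : E^T = E ->
  \tr (E *m A) = \sum_i \sum_j E i j * A i j.
Proof.
move=> ET; rewrite /mxtrace (eq_bigr (fun i => \sum_j E i j * A j i)).
  rewrite exchange_big; apply: eq_bigr => i _; apply: eq_bigr => j _.
  by rewrite -[in LHS]ET mxE.
by move=> i _; rewrite mxE.
Qed.

Lemma jinner_self J : J2 J -> jinner J J = J.1.1 ^+ 2 +
  \sum_i J.1.2 0 i ^+ 2 + \sum_i \sum_j J.2 i j ^+ 2.
Proof. by move=> JT; rewrite /jinner trace_sym. Qed.

Lemma le_jnorm J : J2 J -> [/\ `|J.1.1| <= jnorm J,
  forall i, `|J.1.2 0 i| <= jnorm J & forall i j, `|J.2 i j| <= jnorm J].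
Proof.
move=> JT.
have s1 : 0 <= \sum_i J.1.2 0 i ^+ 2 by apply: sumr_ge0 => i _; exact: sqr_ge0.
have s3 i : 0 <= \sum_j J.2 i j ^+ 2 by apply: sumr_ge0 => j _; exact: sqr_ge0.
have s2 : 0 <= \sum_i \sum_j J.2 i j ^+ 2 by apply: sumr_ge0 => i _.
have s0 : 0 <= J.1.1 ^+ 2 by exact: sqr_ge0.
have H a : a ^+ 2 <= jinner J J -> `|a| <= jnorm J.
  by move=> h; rewrite -sqrtr_sqr ler_sqrt// (le_trans _ h)// sqr_ge0.
rewrite jinner_self// in H; split=> [|i|i j]; apply: H.
- lra.
- suff : J.1.2 0 i ^+ 2 <= \sum_i J.1.2 0 i ^+ 2 by lra.
  by rewrite (bigD1 i)//= lerDl; apply: sumr_ge0 => k _; exact: sqr_ge0.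
- have h1 : J.2 i j ^+ 2 <= \sum_j J.2 i j ^+ 2.
    by rewrite (bigD1 j)//= lerDl; apply: sumr_ge0 => k _; exact: sqr_ge0.
  suff : \sum_j J.2 i j ^+ 2 <= \sum_i \sum_j J.2 i j ^+ 2 by lra.
  by rewrite [leRHS](bigD1 i)//= lerDl; apply: sumr_ge0 => k _.
Qed.

Lemma jnorm_gt0 J : J2 J -> J != 0 -> 0 < jnorm J.
Proof.
move=> JT J0; rewrite lt_neqAle sqrtr_ge0 andbT eq_sym.
apply/negP => /eqP N0; move/negP: J0; apply.
have [h1 h2 h3] := le_jnorm JT; rewrite N0 in h1 h2 h3.
move: h1 h2 h3; case: J JT {N0} => [[r p] A] /= _ h1 h2 h3.
have -> : r = 0 by apply/eqP; rewrite -normr_le0.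
have -> : p = 0.
  by apply/rowP => i; rewrite mxE; apply/eqP; rewrite -normr_le0.
have -> : A = 0.
  by apply/matrixP => i j; rewrite mxE; apply/eqP; rewrite -normr_le0.
by [].
Qed.

(** Only the linear growth in [K] and the uniformity in [J] matter here, so the
    constant is the crude one obtained coordinate by coordinate. *)
Lemma jinner_bound : exists2 C : R, 0 <= C & forall J K, J2 J ->
  `|jinner J K| <= C * jnorm J * `|K|.
Proof.
exists (1 + n%:R + n%:R * n%:R); first by rewrite !addr_ge0 ?mulr_ge0.
move=> J K JT; have [h1 h2 h3] := le_jnorm JT.
have N0 : 0 <= jnorm J by exact: sqrtr_ge0.
have [k1 k2 k3] : [/\ `|K.1.1| <= `|K|, `|K.1.2| <= `|K| & `|K.2| <= `|K|].
  case: K => [[r p] A]; rewrite !prod_normE/=.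
  by split; rewrite !le_max ?lexx ?orbT.
rewrite /jinner trace_sym// (le_trans (ler_normD _ _))// -!mulrA 2!mulrDl mul1r.
apply: lerD; first apply: le_trans (ler_normD _ _) _; first apply: lerD.
- by rewrite normrM ler_pM.
- apply: le_trans (ler_norm_sum _ _ _) _; apply: sum_le_const => i.
  by rewrite normrM ler_pM// (le_trans (coord_le_norm _ _ _)).
- apply: le_trans (ler_norm_sum _ _ _) _; rewrite -mulrA.
  apply: sum_le_const => i.
  apply: le_trans (ler_norm_sum _ _ _) _; apply: sum_le_const => j.
  by rewrite normrM ler_pM// (le_trans (coord_le_norm _ _ _)).
Qed.

End JetAlgebra.


(** * Upper semicontinuous functions and sup-convolution *)

Section SupConvolution.
Context {R : realType} {n : nat}.
Notation V := 'rV[R]_n.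
Implicit Types (x y z : V) (i j : 'I_n).

Lemma ereal_between (a : \bar R) (c : R) : (a < c%:E)%E ->
  exists2 m : R, (a < m%:E)%E & m < c.
Proof.
case: a => [r| |]//; rewrite ?lte_fin => rc.
- by exists ((r + c) / 2); rewrite ?lte_fin; lra.
- by exists (c - 1); [exact: ltNyr|lra].
Qed.

Lemma usc_near (K : set V) (g : V -> \bar R) x (m : R) :
  @lower_semicontinuous (subspace K) R (fun x => - g x)%E -> K x ->
  (g x < m%:E)%E -> \forall y \near x, K y -> (g y < m%:E)%E.
Proof.
move=> sg Kx gm; have [|U xU UP] := sg x (- m); first by rewrite EFinN lteN2.
have KU : within K (nbhs x) U by rewrite (nbhs_subspace_in Kx).
have {}KU : nbhs x [set y | K y -> U y] := KU.
apply: filterS KU => y Uy Ky.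
by have := UP y (Uy Ky); rewrite EFinN lteN2.
Qed.

Lemma usc_bounded (K : set V) (g : V -> \bar R) (p : V -> R) : compact K ->
  usc_on K g -> continuous p ->
  exists B : R, forall x, K x -> (g x <= (B - p x)%:E)%E.
Proof.
move=> /compact_near_coveringP cK [gK sg] cp.
have H x : K x -> \forall x' \near x & B \near +oo%R,
    K x' -> (g x' <= (B - p x')%:E)%E.
  move=> Kx; have [m gm] : exists m : R, (g x < m%:E)%E.
    have := gK x Kx; case: (g x) => [r| |]// _.
      by exists (r + 1); rewrite lte_fin; lra.
    by exists 0; exact: ltNyr.
  have gn := usc_near sg Kx gm.
  have pn : \forall y \near x, p y < p x + 1 by apply: cvgr_lt (cp x) _ _; lra.
  near=> y B => Ky.
  have h1 : (g y < m%:E)%E by apply: (near gn y).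
  have h2 : p y < p x + 1 by apply: (near pn y).
  have h3 : m + p x + 1 <= B by near: B; apply: nbhs_pinfty_ge; exact: num_real.
  by apply: ltW; apply: lt_le_trans h1 _; rewrite lee_fin /=; lra.
have [B [_ HB]] := cK _ _ (fun B x => K x -> (g x <= (B - p x)%:E)%E) _ H.
by exists (B + 1) => x Kx; apply: (HB (B + 1)) => //; lra.
Unshelve. all: by end_near. Qed.

(** If the supremum were not attained, compactness would bound [g + p] away from it
    by a fixed amount. *)
Lemma usc_max (K : set V) (g : V -> \bar R) (p : V -> R) : compact K ->
  usc_on K g -> continuous p -> (exists2 x, K x & (-oo < g x)%E) ->
  exists M y, [/\ K y, g y = (M - p y)%:E &
    forall x, K x -> (g x <= (M - p x)%:E)%E].
Proof.
move=> cK ug cp [x0 Kx0 gx0].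
have [B gB] := usc_bounded cK ug cp; have [gK sg] := ug.
pose S := [set v : R | exists2 y, K y & ((v - p y)%:E <= g y)%E].
have S0 : S !=set0.
  move: gx0 (gK _ Kx0); case E: (g x0) => [r| |]// _ _.
  by exists (r + p x0); exists x0; rewrite // E addrK.
have Sub v : S v -> v <= B.
  move=> [y Ky vy]; have := le_trans vy (gB y Ky).
  by rewrite lee_fin; lra.
have Ssup : has_sup S by split => //; exists B => v /Sub.
pose M := sup S.
have gM x : K x -> (g x <= (M - p x)%:E)%E.
  move=> Kx; move: (gK _ Kx); case E: (g x) => [r| |]// _; last exact: leNye.
  rewrite lee_fin lerBrDr; apply: (ub_le_sup Ssup.2).
  by exists x; rewrite // E addrK.
have [[y Ky My]|noy] := pselect (exists2 y, K y & ((M - p y)%:E <= g y)%E).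
  by exists M, y; split => //; apply/eqP; rewrite eq_le gM.
exfalso.
have lt x : K x -> (g x < (M - p x)%:E)%E.
  by move=> Kx; rewrite ltNge; apply/negP => h; apply: noy; exists x.
have H x : K x -> \forall x' \near x & e \near (0 : R)^'+,
    K x' -> (g x' < (M - p x' - e)%:E)%E.
  move=> Kx; have [m gm mM] := ereal_between (lt x Kx).
  pose d := (M - p x - m) / 2.
  have d0 : 0 < d by rewrite /d; lra.
  have gn := usc_near sg Kx gm.
  have pn : \forall y \near x, p y < p x + d by apply: cvgr_lt (cp x) _ _; lra.
  near=> y e => Ky'.
  have h1 : (g y < m%:E)%E by apply: (near gn y).
  have h2 : p y < p x + d by apply: (near pn y).
  have h3 : e <= d by near: e; exact: nbhs_right_le.
  by apply: lt_le_trans h1 _; rewrite lee_fin /=; move: h2 h3; rewrite /d; lra.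
move/compact_near_coveringP : cK => cK.
have cov := cK _ _ (fun e x => K x -> (g x < (M - p x - e)%:E)%E) _ H.
near (0 : R)^'+ => e.
have e0 : 0 < e by near: e; exact: nbhs_right_gt.
have He : K `<=` (fun x => K x -> (g x < (M - p x - e)%:E)%E).
  by near: e; exact: cov.
have : M <= M - e.
  apply: ge_sup => // v [y Ky vy].
  by have := le_lt_trans vy (He y Ky Ky); rewrite lte_fin; lra.
lra.
Unshelve. all: by end_near. Qed.

(** Truncating the quadratic penalty at height 1, coordinate by coordinate,
    makes it globally Lipschitz while keeping it semiconcave. *)
Definition clip (s : R) : R := Num.min (s ^+ 2) 1.

Lemma clip_ge0 s : 0 <= clip s.
Proof. by rewrite le_min sqr_ge0 ler01. Qed.

Lemma clip_le1 s : clip s <= 1. Proof. by rewrite ge_min lexx orbT. Qed.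
Lemma clip_sqr s : clip s <= s ^+ 2. Proof. by rewrite ge_min lexx. Qed.

Lemma clip_cases s : clip s = s ^+ 2 /\ s ^+ 2 <= 1 \/ clip s = 1.
Proof. by rewrite /clip; case: leP => h; [left|right]. Qed.

Lemma clip_lip s t : clip s <= clip t + 2 * `|s - t|.
Proof.
have [[tE t1]|tE] := clip_cases t; rewrite tE; last first.
  by have := clip_le1 s; have := normr_ge0 (s - t); lra.
have h1 := clip_le1 s; have h2 := clip_sqr s.
set d := `|s - t|; have d0 : 0 <= d by exact: normr_ge0.
have d2 : d ^+ 2 = (s - t) ^+ 2 by rewrite real_normK ?num_real.
have t0 := normr_ge0 t.
have tt : `|t| ^+ 2 = t ^+ 2 by rewrite real_normK ?num_real.
have sd : s ^+ 2 <= t ^+ 2 + 2 * (`|t| * d) + d ^+ 2.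
  have : t * (s - t) <= `|t| * d by rewrite -normrM ler_norm.
  by rewrite d2; nra.
have [td|td] := leP (`|t| + d) 1; nra.
Qed.

Lemma clip_semiconcave s t : clip (s + t) + clip (s - t) <= 2 * clip s + 2 * t ^+ 2.
Proof.
have [[sE _]|sE] := clip_cases s; rewrite sE.
  by have := clip_sqr (s + t); have := clip_sqr (s - t); nra.
by have := clip_le1 (s + t); have := clip_le1 (s - t); have := sqr_ge0 t; lra.
Qed.

Definition penalty (k : R) z : R := k * \sum_i clip (z 0 i).

Lemma penalty0 k : penalty k 0 = 0.
Proof.
rewrite /penalty big1 ?mulr0// => i _.
by rewrite mxE /clip expr0n; apply/min_idPl; exact: ler01.
Qed.

Lemma penalty_ge0 k z : 0 <= k -> 0 <= penalty k z.
Proof. by move=> k0; rewrite mulr_ge0// sumr_ge0// => i _; exact: clip_ge0. Qed.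

Lemma penalty_lip k y z : 0 <= k ->
  penalty k y <= penalty k z + k * (n%:R * 2) * `|y - z|.
Proof.
move=> k0; rewrite /penalty -!mulrA -mulrDr ler_wpM2l//.
rewrite -lerBlDl -sumrB; apply: sum_le_const => i; rewrite lerBlDl.
apply: le_trans (clip_lip _ (z 0 i)) _; rewrite lerD2l ler_wpM2l//.
by have := coord_le_norm (y - z) 0 i; rewrite !mxE.
Qed.

Lemma penalty_semiconcave k y z : 0 <= k ->
  penalty k (y + z) + penalty k (y - z) <=
    2 * penalty k y + k * (n%:R * 2) * `|z| ^+ 2.
Proof.
move=> k0; rewrite /penalty mulrCA -!mulrA -!mulrDr ler_wpM2l//.
rewrite -big_split/= mulr_sumr -lerBlDl -sumrB; apply: sum_le_const => i.
rewrite lerBlDl !mxE; apply: le_trans (clip_semiconcave _ _) _.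
rewrite lerD2l ler_wpM2l// -[leLHS]real_normK ?num_real//.
by rewrite ler_pXn2r ?nnegrE ?coord_le_norm.
Qed.

Lemma penalty_small k z c d : 0 < k -> 0 < d -> c < k -> c < k * d ^+ 2 ->
  penalty k z <= c -> `|z| < d.
Proof.
move=> k0 d0 ck ckd zc.
have [->|z0] := eqVneq z 0; first by rewrite normr0.
have /mx_norm_neq0[[a i] /= E] : mx_norm z != 0.
  by rewrite -[mx_norm _]/(`|z|) normr_eq0.
rewrite -[`|z|]/(mx_norm z) E (ord1 a).
have h : k * clip (z 0 i) <= c.
  apply: le_trans zc; rewrite ler_wpM2l ?(ltW k0)//.
  by rewrite (bigD1 i)//= lerDl sumr_ge0// => j _; exact: clip_ge0.
have [[zE _]|zE] := clip_cases (z 0 i); last by rewrite zE mulr1 in h; lra.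
have : z 0 i ^+ 2 < d ^+ 2.
  by rewrite -(ltr_pM2l k0); apply: le_lt_trans ckd; rewrite -zE.
rewrite -[ltLHS]real_normK ?num_real// ltr_pXn2r// nnegrE; exact: ltW.
Qed.

(** The supremum defining [f] is attained, at the point [Y x]; Lipschitz and
    semiconvexity constants come from those of the penalty alone, although [u]
    is only semicontinuous and may take the value -oo. *)
Lemma sup_convolution (K : set V) (u : V -> \bar R) (k : R) : 0 <= k ->
  compact K -> usc_on K u -> (exists2 x, K x & (-oo < u x)%E) ->
  exists (f : V -> R) (Y : V -> V),
    [/\ forall x, K (Y x) /\ u (Y x) = (f x + penalty k (x - Y x))%:E,
        forall x y, K y -> (u y <= (f x + penalty k (x - y))%:E)%E,
        Lip (k * (n%:R * 2)) f & semiconvex (k * (n%:R * 2)) f].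
Proof.
move=> k0 cK uu ex.
have H x : exists My : R * V, [/\ K My.2,
    u My.2 = (My.1 + penalty k (x - My.2))%:E &
    forall y, K y -> (u y <= (My.1 + penalty k (x - y))%:E)%E].
  have cp : continuous (fun y => - penalty k (x - y)).
    apply: (@lipschitz_continuous _ _ _ (k * (n%:R * 2))) => y z.
    have h1 := penalty_lip (x - y) (x - z) k0.
    have := penalty_lip (x - z) (x - y) k0; rewrite distrC => h2.
    have E : `|x - y - (x - z)| = `|y - z|.
      by rewrite opprB addrC addrA subrK -normrN opprB.
    by rewrite E in h1 h2; rewrite ler_norml; apply/andP; split; lra.
  have [M [y [Ky uy My]]] := usc_max cK uu cp ex.
  exists (M, y); split => //=; first by rewrite uy opprK.
  by move=> z Kz; have := My z Kz; rewrite opprK.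
have [F HF] := choice H.
pose f x := (F x).1; pose Y x := (F x).2.
have Yat x : K (Y x) /\ u (Y x) = (f x + penalty k (x - Y x))%:E.
  by have [] := HF x.
have fub x y : K y -> (u y <= (f x + penalty k (x - y))%:E)%E.
  by have [_ _] := HF x; apply.
have shift x y : f x + penalty k (x - Y x) <= f y + penalty k (y - Y x).
  have [KY uY] := Yat x; have := fub y (Y x) KY.
  by rewrite uY lee_fin.
exists f, Y; split => //.
- have h x y : f x <= f y + k * (n%:R * 2) * `|x - y|.
    have := shift x y; have := penalty_lip (y - Y x) (x - Y x) k0.
    by rewrite opprB addrA subrK distrC; lra.
  move=> x y; have := h x y; have := h y x; rewrite distrC => ? ?.
  by rewrite ler_norml; apply/andP; split; lra.
- move=> x z; have := shift x (x + z); have := shift x (x - z).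
  have := penalty_semiconcave (x - Y x) z k0.
  rewrite -[x + z - _]addrA [z - _]addrC addrA.
  rewrite -[x - z - _]addrA [- z - _]addrC addrA; lra.
Qed.

End SupConvolution.


(** * From viscosity notions to smooth test functions *)

Section Comparison.
Context {R : realType} {n : nat}.
Notation V := 'rV[R]_n.
Implicit Types (x y z : V) (i j : 'I_n) (K J : jet R n).

Lemma near_norm x (P : V -> Prop) : (\forall y \near x, P y) ->
  exists2 d : R, 0 < d & forall y, `|y - x| < d -> P y.
Proof.
move=> /nbhs_normP[d /= d0 dP]; exists d => // y yx.
by apply: dP; rewrite /= distrC.
Qed.

Lemma norm_near x (P : V -> Prop) (d : R) : 0 < d ->
  (forall y, `|y - x| < d -> P y) -> \forall y \near x, P y.
Proof.
move=> d0 dP; apply/nbhs_normP; exists d => // y /=.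
by rewrite distrC; exact: dP.
Qed.

Lemma smooth2_jet (f : V -> R) G H x : smooth2 f G H ->
  C2_near f x /\ jet_of f x = (f x, \row_i G i x, \matrix_(i, j) H i j x).
Proof.
move=> [fG GH cG cH].
have p1 i : partial i f = G i.
  by apply/funext => y; have d := fG y i; rewrite /partial derive_val.
have p2 i j : partial j (partial i f) = H i j.
  by apply/funext => y; rewrite p1; have d := GH i y j; rewrite /partial derive_val.
split; last first.
  rewrite /jet_of; congr (_, _, _).
    by apply/rowP => i; rewrite !mxE p1.
  by apply/matrixP => i j; rewrite !mxE p2.
split=> [|i]; apply: (@norm_near x _ 1 ltr01) => y _ j.
- by split; [have [] := fG y j|rewrite p1; exact: cG].
- by split; [rewrite p1; have [] := GH i y j|rewrite p2; exact: cH].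
Qed.

Lemma smooth2_shift (f : V -> R) G H z : smooth2 f G H ->
  smooth2 (fun y => f (y + z)) (fun i y => G i (y + z)) (fun i j y => H i j (y + z)).
Proof.
have cz : continuous (fun y => y + z).
  by move=> y; apply: (@cvgD _ _ _ (nbhs y)); [exact: cvg_id|exact: cvg_cst].
move=> [fG GH cG cH]; split.
- by move=> y i; exact: (@is_derive_shift _ _ _ f y z (e_ i) _).1 (fG _ _).
- by move=> i y j; exact: (@is_derive_shift _ _ _ (G i) y z (e_ j) _).1 (GH _ _ _).
- move=> i y; exact: cvg_comp (cz y) (cG i (y + z)).
- move=> i j y; exact: cvg_comp (cz y) (cH i j (y + z)).
Qed.

Lemma lsc_usc (D : set V) (w : V -> \bar R) : lsc_on D w ->
  usc_on D (fun x => - w x)%E.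
Proof.
move=> [wD lw]; split; last by under eq_fun do rewrite oppeK.
by move=> x /wD; case: (w x) => [r| |]//= _; rewrite ltry.
Qed.

Lemma compact_closure_bounded (Om : set V) : bounded_set Om -> compact (closure Om).
Proof.
move=> [M [Mr bM]]; apply: bounded_closed_compact; last exact: closed_closure.
exists (M + 1); split; first exact: num_real.
move=> m mM x clx; apply: (le_trans _ (ltW mM)).
have cl : closed [set y : V | `|y| <= M + 1].
  rewrite (_ : [set _ | _] = (fun y : V => `|y|) @^-1` [set t | t <= M + 1])//.
  apply: closed_comp; last exact: closed_le.
  move=> y _; apply: (@lipschitz_continuous _ _ _ 1) => y1 y2.
  by rewrite mul1r ler_dist_dist.
suff : closure Om `<=` [set y : V | `|y| <= M + 1] by apply.
rewrite closureE => y; apply; split => // z; apply: bM; lra.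
Qed.

Section core.
Variables (Sigma : Type) (S : Sigma -> jet R n) (J0 : jet R n).
Hypotheses (Sigma_inh : inhabited Sigma) (S_neq0 : forall s, S s != 0)
  (S_coef : forall s, NxRnxP (S s)) (S_pointed : pointed_with_axis S J0).

Lemma S_sym s : J2 (S s).
Proof. by have [_ []] := S_coef s. Qed.

Lemma axis_gt0 s : 0 < jinner (S s) J0.
Proof.
have [_ _ [eps e0 he]] := S_pointed; apply: lt_le_trans (he s).
by rewrite mulr_gt0// jnorm_gt0//; exact: S_sym.
Qed.

Lemma FbarD s K J : Fbar S J0 s (K + J) = Fbar S J0 s K + Fbar S J0 s J.
Proof. by rewrite /Fbar jinnerD mulrDl. Qed.

Lemma FbarZ s (c : R) K : Fbar S J0 s (c *: K) = c * Fbar S J0 s K.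
Proof. by rewrite /Fbar jinnerZ mulrA. Qed.

Lemma Fbar_axis s : Fbar S J0 s J0 = 1.
Proof. by rewrite /Fbar mulfV// gt_eqF// axis_gt0. Qed.

(** Pointedness bounds [jnorm (S s)] by a multiple of the normalizing factor, so
    the normalized operators are bounded uniformly in [s]. *)
Lemma Fbar_bound : exists2 C : R, 0 <= C & forall s K,
  `|Fbar S J0 s K| <= C * `|K|.
Proof.
have [C C0 hC] := @jinner_bound R n; have [_ _ [eps e0 he]] := S_pointed.
exists (C / eps); first by rewrite divr_ge0// ltW.
move=> s K; have p := axis_gt0 s.
rewrite /Fbar normrM normfV (gtr0_norm p) ler_pdivrMr//.
apply: le_trans (hC _ K (S_sym s)) _; rewrite -!mulrA ler_wpM2l//.
rewrite mulrCA [jnorm _ * _]mulrC ler_wpM2l//.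
by rewrite mulrC ler_pdivlMr// mulrC.
Qed.

Lemma has_inf_Fbar K : has_inf (range (fun s => Fbar S J0 s K)).
Proof.
have [C C0 hC] := Fbar_bound; have [s] := Sigma_inh; split.
  by exists (Fbar S J0 s K), s.
exists (- (C * `|K|)) => _ [t _ <-].
by have := hC t K; rewrite ler_norml => /andP[].
Qed.

Lemma Finf_le s K : Finf S J0 K <= Fbar S J0 s K.
Proof. by apply: ge_inf; [exact: (has_inf_Fbar K).2|exists s]. Qed.

Lemma le_Finf c K : (forall s, c <= Fbar S J0 s K) -> c <= Finf S J0 K.
Proof.
move=> h; apply: lb_le_inf; first exact: (has_inf_Fbar K).1.
by move=> _ [s _ <-].
Qed.

(** A boundary point [x] has [u x <= w x]; by semicontinuity and compactness, no
    pair of nearby points where [u] exceeds [w] by [m] can then lie close to the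
    boundary. *)
Lemma touching_localized (Om : set V) (u w : V -> \bar R) (m : R) : 0 < m ->
  open Om -> compact (closure Om) -> usc_on (closure Om) u ->
  lsc_on (closure Om) w -> (forall x, bdry Om x -> (u x <= w x)%E) ->
  exists2 d : R, 0 < d & forall x y (r s : R),
    closure Om x -> closure Om y -> `|x - y| < d ->
    (r%:E <= u y)%E -> (w x <= s%:E)%E -> m <= r - s ->
    forall z, `|z - x| < d -> Om z.
Proof.
move=> m0 oOm /compact_near_coveringP cK [uK su] [wK lw] bd.
pose P (d : R) x := forall y (r s : R), closure Om x -> closure Om y ->
  `|x - y| < d -> (r%:E <= u y)%E -> (w x <= s%:E)%E -> m <= r - s ->
  forall z, `|z - x| < d -> Om z.
have H x : closure Om x -> \forall x' \near x & d \near (0 : R)^'+, P d x'.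
  move=> Kx; have [Ox|nOx] := pselect (Om x).
    have [d d0 dOm] := near_norm (open_nbhs_nbhs (conj oOm Ox)).
    have xn : \forall y \near x, `|y - x| < d / 2.
      by apply: (@norm_near _ _ (d / 2)) => //; lra.
    near=> x' e => y r s _ _ _ _ _ _ z /= ze; apply: dOm.
    have h1 : `|x' - x| < d / 2 by apply: (near xn x').
    have h2 : e <= d / 2 by near: e; apply: nbhs_right_le; lra.
    by have := ler_normD (z - x') (x' - x); rewrite addrA subrK; lra.
  have ux : (u x <= w x)%E by apply: bd; split => // /interior_subset.
  have [al [be [ual wbe abm]]] : exists al be : R,
      [/\ (u x < al%:E)%E, (be%:E < w x)%E & al - be < m].
    move: (uK _ Kx) (wK _ Kx) ux; case: (u x) => [r| |]// _.
      move=> _ rw; exists (r + m / 3), (r - m / 3); split; [|apply: (lt_le_trans _ rw)|];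
        by rewrite ?lte_fin; lra.
    case: (w x) => [s| |]// _ _.
      exists (s - 1), (s - 1); split; first exact: ltNyr; rewrite ?lte_fin; lra.
    by exists 0, 0; split; rewrite ?ltNyr ?ltry// subr0.
  have [d1 d10 hd1] := near_norm (usc_near su Kx ual).
  have [_ sw] := lsc_usc (conj wK lw).
  have wbe' : (- w x < (- be)%:E)%E by rewrite EFinN lteN2.
  have [d2 d20 hd2] := near_norm (usc_near sw Kx wbe').
  have xn1 : \forall y \near x, `|y - x| < d1 / 2.
    by apply: (@norm_near _ _ (d1 / 2)) => //; lra.
  have xn2 : \forall y \near x, `|y - x| < d2.
    exact: (@norm_near _ _ d2).
  near=> x' e => y r s /= Kx' Ky xy ru ws rs.
  have h1 : `|x' - x| < d1 / 2 by apply: (near xn1 x').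
  have h2 : `|x' - x| < d2 by apply: (near xn2 x').
  have h3 : e <= d1 / 2 by near: e; apply: nbhs_right_le; lra.
  have yx : `|y - x| < d1.
    have := ler_normD (y - x') (x' - x); rewrite addrA subrK distrC [`|y - x'|]distrC.
    by rewrite [`|x - y|]distrC; lra.
  have ra : r < al by rewrite -lte_fin; apply: le_lt_trans ru (hd1 y yx Ky).
  have sb : be < s.
    rewrite -lte_fin; apply: (lt_le_trans _ ws).
    by have := hd2 x' h2 Kx'; rewrite EFinN lteN2.
  lra.
have cov := cK _ _ P _ H.
near (0 : R)^'+ => d.
have d0 : 0 < d by near: d; exact: nbhs_right_gt.
have hd : closure Om `<=` P d by near: d; exact: cov.
by exists d => // x y r s Kx; apply: (hd x Kx).
Unshelve. all: by end_near. Qed.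

End core.
End Comparison.


(** * Comparison in the presence of a strict approximator *)

Section ComparisonMain.
Context {R : realType} {n : nat}.
Notation V := 'rV[R]_n.
Implicit Types (x y z : V) (i j : 'I_n) (K J : jet R n).
Variables (Sigma : Type) (S : Sigma -> jet R n) (J0 : jet R n).
Hypotheses (Sigma_inh : inhabited Sigma) (S_neq0 : forall s, S s != 0)
  (S_coef : forall s, NxRnxP (S s)) (S_pointed : pointed_with_axis S J0).

(** Two box averages in each direction make a mollification twice
    differentiable; the third one makes its second derivatives regular enough
    for the random walk to move them slowly. *)
Definition dirs : seq 'I_n := enum 'I_n ++ enum 'I_n ++ enum 'I_n.

Lemma dirs_count i : (2 < count_mem i dirs)%N.
Proof. by rewrite /dirs !count_cat count_uniq_mem ?enum_uniq// mem_enum. Qed.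

(** Properness ([(S s).1.1 <= 0]) absorbs the upward shift of the value, and
    translation invariance carries the test function from [x] to the point where
    the supremum defining [f] is attained. *)
Lemma sup_convolution_subsolution (Om : set V) (u : V -> \bar R) (c : R)
    (f : V -> R) (p : V -> R) x y s es :
  open Om -> Om y -> viscosity_subsolution (Finf S J0) c Om u ->
  (forall z, 0 <= p z) ->
  u y = (f x + p (x - y))%:E ->
  (forall x' y', closure Om y' -> (u y' <= (f x' + p (x' - y'))%:E)%E) ->
  (forall A, \tr ((S s).2 *m A) = \sum_(e <- es) dot (e *m A) e) ->
  forall phi G H, smooth2 phi G H -> (forall z, f z <= phi z) -> f x = phi x ->
  c * jinner (S s) J0 <= (S s).1.1 * f x + walk_op (S s).1.2 es G H x.
Proof.
move=> oOm Oy su p0 uy fub sE phi G H S2 fphi fx.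
have S3 := smooth2_addc (p (x - y)) (smooth2_shift (x - y) S2).
have [C2 jE] := smooth2_jet y S3.
have ynear : \forall z \near y, (u z <= (phi (z + (x - y)) + p (x - y))%:E)%E.
  have [d d0 dOm] := near_norm (open_nbhs_nbhs (conj oOm Oy)).
  apply: (@norm_near _ _ y _ d) => // z zy.
  apply: (le_trans (fub (z + (x - y)) z (subset_closure (dOm z zy)))).
  by rewrite [z + _]addrC addrK lee_fin lerD2r; apply: fphi.
have uphi : u y = (phi (y + (x - y)) + p (x - y))%:E by rewrite subrKC -fx.
rewrite subrKC in jE.
have := su y _ Oy C2 ynear uphi; rewrite jE.
move=> /le_trans/(_ (Finf_le Sigma_inh S_neq0 S_coef S_pointed s _)).
rewrite /Fbar ler_pdivlMr; last exact: axis_gt0.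
rewrite (jinner_walk_op _ G H x sE) -fx => h; apply: le_trans h _.
rewrite lerD2r mulrDr gerDl mulr_le0_ge0//.
by have [] := S_coef s.
Qed.

(** Suppose [u > w] somewhere and let [f] be a sup-convolution of [u] and [v] a
    mollification of [f].  The maximum of [v + eps * psi - w] is positive and, by
    [touching_localized], attained far enough from the boundary for [v] to be a
    classical subsolution of each linear operator.  There
    [v + eps * psi - M1] touches [w] from below, while superadditivity of the
    infimum makes the operator at least [c + eps * kappa] on its jet. *)
Lemma comparison_of_approximator (psi : V -> R) Gp Hp (c : R) (Om : set V) :
  domain Om -> bounded_set Om -> continuous psi -> smooth2 psi Gp Hp ->
  (forall x, closure Om x -> psi x <= 0) ->
  (forall x, Om x -> exists2 kappa : R, 0 < kappa & forall s,
     kappa * jinner (S s) J0 <=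
       jinner (S s) (psi x, \row_i Gp i x, \matrix_(i, j) Hp i j x)) ->
  comparison (Finf S J0) c Om.
Proof.
move=> [oOm _ _] bOm cpsi psi2 psi0 psiS u w uu lw su sw bd x Ox.
have cK := compact_closure_bounded bOm.
have clO y : Om y -> closure Om y := @subset_closure _ Om y.
have [uK usc] := uu; have [wK lsc] := lw; have wu := lsc_usc lw.
rewrite leNgt; apply/negP => wltu.
have [r [s [ur ws]]] : exists r s : R, u x = r%:E /\ w x = s%:E.
  move: (uK _ (clO _ Ox)) (wK _ (clO _ Ox)) wltu.
  case: (u x) => [r| |]//; case: (w x) => [s| |]// _ _ _.
  by exists r, s.
rewrite ur ws lte_fin in wltu.
pose m := (r - s) / 4; have m0 : 0 < m by rewrite /m; lra.
have psix := psi0 x (clO _ Ox).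
have px1 : 0 < 1 - psi x by lra.
pose eps := (2 * m) / (1 - psi x).
have eps0 : 0 < eps by rewrite divr_gt0//; lra.
have epsx : - (2 * m) <= eps * psi x.
  have : eps * (1 - psi x) = 2 * m by rewrite divfK// gt_eqF.
  rewrite mulrBr mulr1; lra.
have [d d0 loc] := touching_localized m0 oOm cK uu lw bd.
have c0 : continuous (fun _ : V => 0 : R) by exact: cst_continuous.
have [Mu uMu] := usc_bounded cK uu c0; have [Mw wMw] := usc_bounded cK wu c0.
pose c1 := `|Mu| + `|Mw| + 1.
have c10 : 0 < c1 by rewrite /c1 ltr_wpDl// addr_ge0.
(* The penalties at the maximum are at most [c1], whatever [k] is; a large
   weight [k] thus keeps the points [y] and [Y y] close to each other. *)
pose k := c1 + 1 + (c1 + 1) / (d / 2) ^+ 2.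
have d20 : 0 < (d / 2) ^+ 2 by rewrite exprn_gt0// divr_gt0.
have k1 : c1 < k.
  have : 0 < (c1 + 1) / (d / 2) ^+ 2 by rewrite divr_gt0//; lra.
  by rewrite /k; lra.
have k2 : c1 < k * (d / 2) ^+ 2.
  rewrite /k mulrDl divfK ?gt_eqF//.
  have : 0 < (c1 + 1) * (d / 2) ^+ 2 by rewrite mulr_gt0//; lra.
  lra.
have k0 : 0 < k := lt_trans c10 k1.
have exu : exists2 y, closure Om y & (-oo < u y)%E.
  by exists x; [exact: clO|rewrite ur ltNyr].
have [f [Y [Yat fub Lf scf]]] := sup_convolution (ltW k0) cK uu exu.
set L := k * (n%:R * 2) in Lf scf.
have L0 : 0 <= L by rewrite /L !mulr_ge0// ltW.
(* [q] is the radius on which [f] is a subsolution; the mollification, of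
   radius less than [q], also moves [f] by at most [m / 2]. *)
pose q := Num.min (Num.min (d / 2) (L + 1)^-1) (m / (2 * (L + 1))).
have L1 : 0 < L + 1 by rewrite ltr_wpDl.
have q0 : 0 < q.
  rewrite /q !lt_min invr_gt0 L1 !andbT; apply/andP; split.
    by rewrite divr_gt0.
  by apply: divr_gt0 => //; apply: mulr_gt0.
have qd : q <= d / 2 by rewrite !ge_min lexx.
have qL : L * q <= 1.
  have : q * (L + 1) <= 1 by rewrite -ler_pdivlMr// mul1r !ge_min lexx orbT.
  by rewrite mulrDr mulr1 mulrC; lra.
have qm : L * q <= m / 2.
  have : q * (2 * (L + 1)) <= m.
    by rewrite -ler_pdivlMr ?mulr_gt0// !ge_min lexx !orbT.
  by have := ltW q0; rewrite mulrDr mulr1 mulrDr mulrCA [q * L]mulrC; lra.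
pose D := size dirs; have D0 : 0 <= D%:R :> R by exact: ler0n.
pose h := q / (D%:R + 1).
have h0 : 0 < h by rewrite divr_gt0// ltr_wpDl.
have hq : h *+ D < q.
  rewrite -mulr_natr /h mulrAC ltr_pdivrMr ?ltr_wpDl//; nra.
set rho := h *+ D in hq.
have rho0 : 0 <= rho by rewrite mulrn_wge0// ltW.
have Lrho : L * rho <= m / 2.
  by apply: le_trans qm; rewrite ler_wpM2l// ltW.
pose v := smooth h dirs f.
have aS : average rho _ := smooth_average dirs h0.
have vf y : `|v y - f y| <= m / 2 := le_trans (average_near y aS L0 Lf) Lrho.
have vL : Lip L v := average_Lip aS Lf.
have cp : continuous (fun y => v y + eps * psi y).
  move=> y; apply: (@cvgD _ R^o _ (nbhs y)).
    exact: (@lipschitz_continuous _ _ _ _ vL).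
  by apply: (@cvgM _ _ (nbhs y)); [exact: cvg_cst|exact: cpsi].
have exw : exists2 y, closure Om y & (-oo < - w y)%E.
  by exists x; [exact: clO|rewrite ws ltNyr].
have [M1 [x1 [Kx1 wx1 wM1]]] := usc_max cK wu cp exw.
pose s1 := v x1 + eps * psi x1 - M1.
have ws1 : w x1 = s1%:E.
  by rewrite -[w x1]oppeK wx1 /s1; congr EFin; rewrite opprB.
have M1m : 3 / 2 * m <= M1.
  have := wM1 x (clO _ Ox); rewrite ws lee_fin.
  have := fub x x (clO _ Ox); rewrite ur subrr penalty0 addr0 lee_fin.
  by have := vf x; rewrite ler_norml => /andP[+ _]; move: (erefl m); rewrite {2}/m; lra.
have psix1 := psi0 x1 Kx1.
have epx1 : eps * psi x1 <= 0 by rewrite mulr_ge0_le0// ltW.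
have fs1 : m <= f x1 - s1.
  by have := vf x1; rewrite ler_norml /s1 => /andP[_]; lra.
have s1w : - Mw <= s1.
  have := wMw x1 Kx1; rewrite ws1 lee_fin; lra.
have fMu y : f y + penalty k (y - Y y) <= Mu.
  by have [KY uY] := Yat y; have := uMu _ KY; rewrite uY lee_fin subr0.
have pos y : 0 <= penalty k y by apply: penalty_ge0; exact: ltW.
have near_x1 y : `|y - x1| <= q -> `|y - Y y| < d / 2.
  move=> yq; apply: (@penalty_small R n k _ c1) => //; first by lra.
  have := fMu y; have := Lf y x1; have := ler_wpM2l L0 yq.
  have := ler_norm Mu; have := ler_norm Mw; rewrite /c1 ler_norml.
  by move=> ? ? ? /andP[? ?] ?; lra.
have d2d : d / 2 < d by lra.
have ball_Om z : `|z - x1| < d -> Om z.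
  have [KY uY] := Yat x1.
  apply: (loc x1 (Y x1) (f x1 + penalty k (x1 - Y x1)) s1 Kx1 KY).
  - apply: lt_trans (near_x1 x1 _) d2d; by rewrite subrr normr0 ltW.
  - by rewrite uY.
  - by rewrite ws1.
  - by have := pos (x1 - Y x1); lra.
have Ox1 : Om x1 by apply: ball_Om; rewrite subrr normr0.
have vsub s0 es : es != [::] ->
    (forall A, \tr ((S s0).2 *m A) = \sum_(e <- es) dot (e *m A) e) ->
    c * jinner (S s0) J0 <=
      (S s0).1.1 * v x1 + smooth_op h dirs (S s0).1.2 es f x1.
  move=> es0 sE.
  apply: (mollify_subsolution dirs_count es0 L0 L0 h0 hq Lf scf).
  move=> y phi G H yq S2 fphi fy; have [KY uY] := Yat y.
  have OY : Om (Y y).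
    apply: ball_Om; have := near_x1 y (ltW yq).
    have := ler_normD (Y y - y) (y - x1); rewrite addrA subrK [`|Y y - y|]distrC.
    by lra.
  exact: (sup_convolution_subsolution oOm OY su pos uY fub sE S2 fphi fy).
have [[V1 V2 _] [V3 V4 _ _ _]] := smooth_jets h0 dirs_count L0 Lf.
have S0 : smooth2 _ _ _ := And4 V1 V2
  (fun i => lipschitz_continuous (V3 i))
  (fun i j => lipschitz_continuous (V4 i j)).
have S2 := smooth2_addc (- M1) (smooth2D eps S0 psi2).
have [C2 jE] := smooth2_jet x1 S2.
have wnear : \forall y \near x1, ((v y + eps * psi y + - M1)%:E <= w y)%E.
  apply: (@norm_near _ _ x1 _ d) => // y /ball_Om/clO Ky.
  have := wM1 y Ky; move: (wK _ Ky); case: (w y) => [t| |]//=.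
    by rewrite !lee_fin; lra.
  by move=> _ _; rewrite leey.
have := sw x1 _ Ox1 C2 wnear ws1; rewrite jE.
apply/negP; rewrite -ltNge.
have [kappa0 kappa00 hk] := psiS x1 Ox1.
apply: (@lt_le_trans _ _ (c + eps * kappa0)); first by rewrite ltrDl mulr_gt0.
apply: (le_Finf Sigma_inh S_neq0 S_coef S_pointed) => s0.
have ps := axis_gt0 S_neq0 S_coef S_pointed s0.
rewrite /Fbar ler_pdivlMr// mulrDl.
have [a0 Ep] := S_coef s0.
have [es es0 sE] := psd_decomposition_neq0 Ep.
rewrite (jinner_walk_op _ (fun i y => _ + eps * Gp i y)
  (fun i j y => _ + eps * Hp i j y) x1 sE).
rewrite walk_op_axpy.
have h1 := vsub s0 es es0 sE.
have := hk s0; rewrite (jinner_walk_op _ _ _ _ sE) => h2.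
have h3 := ler_wpM2l (ltW eps0) h2.
have h4 : 0 <= - (S s0).1.1 * M1.
  by rewrite mulr_ge0 ?oppr_ge0//; lra.
rewrite -[X in _ <= _ + (X + _)]/(smooth_op h dirs (S s0).1.2 es f x1).
rewrite -/v; set T := walk_op _ _ Gp Hp x1 in h3 *; lra.
Qed.

End ComparisonMain.


(** * The quadratic strict approximator *)

Section Approximator.
Context {R : realType} {n : nat}.
Notation V := 'rV[R]_n.
Implicit Types (x y z : V) (i j : 'I_n) (K J : jet R n).

Lemma small_mul (k a B : R) : 0 <= k -> 0 <= B -> k <= a / (B + 1) -> k * B <= a.
Proof.
move=> k0 B0; rewrite ler_pdivlMr ?ltr_wpDl// mulrDr mulr1; lra.
Qed.

Lemma quadratic_form_bound (A : 'M[R]_n) x :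
  `|dot (x *m A) x| <= (\sum_i \sum_j `|A i j|) * dot x x.
Proof.
have xx i j : `|x 0 i| * `|x 0 j| <= dot x x.
  have sq k : x 0 k ^+ 2 <= dot x x.
    rewrite /dot (bigD1 k)//= expr2 lerDl; apply: sumr_ge0 => l _.
    by rewrite -expr2 sqr_ge0.
  have := sq i; have := sq j.
  rewrite -[x 0 i ^+ 2]real_normK ?num_real// -[x 0 j ^+ 2]real_normK ?num_real//.
  have := sqr_ge0 (`|x 0 i| - `|x 0 j|); nra.
rewrite /dot (eq_bigr (fun j => \sum_i x 0 i * A i j * x 0 j)); last first.
  by move=> j _; rewrite mxE mulr_suml.
rewrite exchange_big mulr_suml; apply: le_trans (ler_norm_sum _ _ _) _.
apply: ler_sum => i _; rewrite mulr_suml; apply: le_trans (ler_norm_sum _ _ _) _.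
apply: ler_sum => j _; rewrite mulrAC normrM normrM mulrC.
by rewrite ler_wpM2l.
Qed.

Lemma psd_perturb (A : 'M[R]_n) (a k : R) : A^T = A -> 0 <= k ->
  k * (\sum_i \sum_j `|A i j|) <= a -> psd (a%:M - k *: A).
Proof.
move=> AT k0 ka; split=> [|x]; first by rewrite linearB linearZ/= tr_scalar_mx AT.
rewrite mulmxBr mul_mx_scalar -scalemxAr -[- (k *: _)]scaleN1r dotDl !dotZl.
have := quadratic_form_bound A x; rewrite ler_norml => /andP[_].
move=> /(ler_wpM2l k0); have := ler_wpM2r (dot_ge0 x) ka; lra.
Qed.

Lemma enorm_lt x (r : R) : enorm x < r -> dot x x < r ^+ 2.
Proof.
move=> xr; have r0 : 0 < r by apply: le_lt_trans xr; exact: sqrtr_ge0.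
have : enorm x ^+ 2 < r ^+ 2.
  by rewrite ltr_pXn2r// nnegrE ?sqrtr_ge0// ltW.
by rewrite sqr_sqrtr// dot_ge0.
Qed.

(** The smallest of the cones with finite radius: passing to a smaller cone enlarges
    the polar, so it suffices to treat this one. *)
Definition elliptic_cone (gamma : R) (D : set V) (rho : R) : set (jet R n) :=
  Mgamma gamma `&` MD D `&` MR rho.

(** The jet of [|x|^2 - C] lies in the interior of the cone when [x] is interior to
    the truncated cone: its gradient [2 *: x] has length less than [2 * rho]
    while its Hessian is twice the identity, and [C] takes care of the value.
    Room in the direction [J0] is exactly what the normalization of the
    operators requires. *)
Lemma approximator_margin (gamma rho C : R) (D : set V) x (d : R) J0 :
  0 <= gamma -> 0 < rho -> cone_set D -> rho ^+ 2 + gamma * (2 * rho) + 1 <= C ->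
  0 < d -> (forall z, `|z - x| < d -> D z) -> dot x x < rho ^+ 2 -> J2 J0 ->
  exists2 kappa : R, 0 < kappa &
    elliptic_cone gamma D rho
      ((dot x x - C, 2 *: x, (2 : R)%:M) - kappa *: J0 : jet R n).
Proof.
case: J0 => [[r0 p0] A0] gamma0 rho0 Dcone hC d0 Dd xrho; rewrite /J2/= => A0T.
pose e := enorm x.
have e0 : 0 <= e := sqrtr_ge0 _.
have ee : e ^+ 2 = dot x x by rewrite sqr_sqrtr// dot_ge0.
have erho : e < rho by rewrite -(ltr_pXn2r (n := 2))// ?nnegrE ?ee// ltW.
(* any value strictly between [2 * e] and [2 * rho] would do *)
pose T := e + rho.
have Te : 0 < T ^+ 2 - 4 * e ^+ 2.
  rewrite (_ : _ - _ = (rho - e) * (rho + 3 * e)); last by rewrite /T; ring.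
  by rewrite mulr_gt0; lra.
pose b1 := 4 * `|dot x p0| + dot p0 p0.
have b10 : 0 <= b1 by rewrite addr_ge0 ?mulr_ge0 ?dot_ge0.
pose CA := \sum_i \sum_j `|A0 i j|.
have CA0 : 0 <= CA by apply: sumr_ge0 => i _; apply: sumr_ge0.
have T2 : 0 < 2 - T / rho by rewrite subr_gt0 ltr_pdivrMr// /T; lra.
pose k1 := (T ^+ 2 - 4 * e ^+ 2) / (b1 + 1).
pose k2 := (2 - T / rho) / (CA + 1).
pose k3 := 1 / (`|r0| + 1).
pose k4 := d / (`|p0| + 1).
pose kappa := Num.min (Num.min (Num.min k1 k2) (Num.min k3 k4)) 1.
have kk1 : 0 < k1 by rewrite divr_gt0// ltr_wpDl.
have kk2 : 0 < k2 by rewrite divr_gt0// ltr_wpDl.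
have kk3 : 0 < k3 by rewrite divr_gt0// ltr_wpDl.
have kk4 : 0 < k4 by rewrite divr_gt0// ltr_wpDl.
have kappa0 : 0 < kappa by rewrite !lt_min kk1 kk2 kk3 kk4 ltr01.
have h1 : kappa <= k1 by rewrite !ge_min lexx.
have h2 : kappa <= k2 by rewrite !ge_min lexx !orbT.
have h3 : kappa <= k3 by rewrite !ge_min lexx !orbT.
have h4 : kappa <= k4 by rewrite !ge_min lexx !orbT.
have h5 : kappa <= 1 by rewrite !ge_min lexx !orbT.
clearbody kappa.
have {}h1 := small_mul (ltW kappa0) b10 h1.
have {}h2 := small_mul (ltW kappa0) CA0 h2.
have {}h3 := small_mul (ltW kappa0) (normr_ge0 _) h3.
have {}h4 := small_mul (ltW kappa0) (normr_ge0 _) h4.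
exists kappa => //.
have pT : enorm (2 *: x - kappa *: p0) <= T.
  rewrite -(ger0_norm (_ : 0 <= T)); last by rewrite addr_ge0// ltW.
  rewrite -sqrtr_sqr ler_sqrt ?sqr_ge0//.
  rewrite -scaleNr dotDl !dotDr !dotZl !dotZr (dotC p0) -ee.
  have := ler_norm (- dot x p0); rewrite normrN => hx.
  have := ler_wpM2l (ltW kappa0) hx.
  have : kappa * (kappa * dot p0 p0) <= kappa * dot p0 p0.
    by rewrite ler_wpM2l ?(ltW kappa0)// ler_piMl ?dot_ge0.
  by move: h1; rewrite /b1; lra.
have AS : (2%:M - kappa *: A0)^T = 2%:M - kappa *: A0 :> 'M[R]_n.
  by rewrite linearB linearZ/= tr_scalar_mx A0T.
split; first split; split => //.
- rewrite /= mulNr lerNr.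
  have := ler_wpM2l gamma0 pT.
  have : gamma * T <= gamma * (2 * rho) by rewrite ler_wpM2l// /T; lra.
  have := ler_norm (- (kappa * r0)); rewrite normrN normrM (gtr0_norm kappa0).
  by rewrite -[_ *: r0]/(kappa * r0); lra.
- rewrite /= (_ : _ - _ = 2 *: (x - (kappa / 2) *: p0)); last first.
    by rewrite scalerBr scalerA mulrCA divff ?mulr1.
  apply: Dcone => //; apply: Dd; rewrite addrC addKr normrN normrZ ger0_norm.
    by rewrite mulrAC; have := normr_ge0 p0; lra.
  by rewrite divr_ge0// ltW.
- rewrite /= linearB linearB linearZ/= !tr_scalar_mx A0T//.
- have -> : (2%:M - kappa *: A0 - (enorm (2 *: x - kappa *: p0) / rho)%:M : 'M[R]_n) =
      (2 - enorm (2 *: x - kappa *: p0) / rho)%:M - kappa *: A0.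
    by rewrite raddfB/= addrAC.
  apply: (psd_perturb A0T (ltW kappa0) _).2.
  apply: le_trans h2 _; rewrite lerD2l lerN2.
  by rewrite ler_wpM2r// invr_ge0 ltW.
Qed.

End Approximator.


(** * Reduction to a single family of monotonicity cones *)

Section Cones.
Context {R : realType} {n : nat}.
Notation V := 'rV[R]_n.
Implicit Types (x y z : V) (i j : 'I_n) (K J : jet R n).

Lemma directional_coneT : directional_cone [set: V].
Proof.
split; [exact: closedT|by []|by move=> x y l _ _; rewrite inE|].
by exists 0; rewrite interiorT.
Qed.

Lemma cone_radius_elliptic (M : set (jet R n)) (D : set V) (rho : R) :
  cone_radius M D rho -> [/\ directional_cone D, 0 < rho &
    exists2 gamma : R, 0 <= gamma & elliptic_cone gamma D rho `<=` M].
Proof.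
case=> [r r0|g r g0 r0|E r dE r0|g E r g0 dE r0]; split => //;
  try exact: directional_coneT.
- by exists 0 => // J [].
- by exists g => // J [[]].
- by exists 0 => // J [[]].
- by exists g.
Qed.

Lemma MR_psd (rho : R) : 0 < rho -> MR rho `<=` @MP R n.
Proof.
move=> r0 [[r p] A] [/= AT Ap]; split => [|x].
  by move: AT; rewrite /= linearB/= tr_scalar_mx => /addIr.
have := Ap x; rewrite mulmxBr mul_mx_scalar dotDl -scaleNr dotZl.
have : 0 <= enorm p / rho * dot x x.
  by rewrite mulr_ge0 ?dot_ge0// divr_ge0 ?sqrtr_ge0// ltW.
lra.
Qed.

(** A cone without a radius contains elliptic cones of every radius, so a bounded
    domain may be treated with a radius as large as its size requires. *)
Lemma cone_bounded_elliptic (M : set (jet R n)) : cone_bounded M ->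
  exists gamma (D : set V), [/\ 0 <= gamma, directional_cone D &
    forall rho, 0 < rho -> elliptic_cone gamma D rho `<=` M].
Proof.
have T := directional_coneT.
case=> [g g0||D dD|g D g0 dD|D dD|g D g0 dD].
- by exists g, setT; split=> // rho r0 J [[]].
- by exists 0, setT; split=> // rho r0 J [_ /(MR_psd r0)].
- by exists 0, D; split=> // rho r0 J [[]].
- by exists g, D; split=> // rho r0 J [].
- by exists 0, D; split=> // rho r0 J [[_ ?] /(MR_psd r0)].
- by exists g, D; split=> // rho r0 J [? /(MR_psd r0)].
Qed.

Lemma polar_anti (M M' : set (jet R n)) : M `<=` M' -> polar M' `<=` polar M.
Proof. by move=> MM J [JJ h]; split => // K /MM /h. Qed.

(** The vertex is moved far away, along a direction interior to the cone. *)
Lemma bounded_in_truncated_cone (D Om : set V) : directional_cone D ->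
  bounded_set Om -> exists x0 rho, 0 < rho /\
    Om `<=` translated_truncated_cone x0 D rho.
Proof.
move=> [_ Dcone _ [e De]] [B0 [_ hB]].
pose B := `|B0| + 1.
have B00 : 0 < B by rewrite ltr_wpDl.
have OB x : Om x -> `|x| <= B.
  by apply: (hB B); rewrite (le_lt_trans (ler_norm _))// ltrDl.
have [d d0 dD] := near_norm De.
pose k := B / d + 1.
have k0 : 0 < k by rewrite ltr_wpDl// divr_ge0// ltW.
pose W := B + k * `|e|.
have W0 : 0 <= W by rewrite addr_ge0 ?mulr_ge0// ltW.
have rho0 : 0 < (n%:R + 1) * (W + 1) by rewrite mulr_gt0// ltr_wpDl ?ler0n.
exists (- (k *: e)), ((n%:R + 1) * (W + 1)); split => // x /OB xB.
rewrite /translated_truncated_cone/= opprK; split.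
  have -> : x + k *: e = k *: (e + k^-1 *: x).
    by rewrite scalerDr scalerA divff ?gt_eqF// scale1r addrC.
  apply: Dcone; first exact: ltW.
  apply: dD; rewrite addrC addKr normrZ ger0_norm ?invr_ge0 ?(ltW k0)//.
  rewrite mulrC ltr_pdivrMr//; apply: le_lt_trans xB _.
  by rewrite /k mulrDr mulrC divfK ?gt_eqF// mulr1 ltrDl.
rewrite -(ger0_norm (ltW rho0)) -sqrtr_sqr ltr_sqrt ?exprn_gt0//.
have xW : `|x + k *: e| <= W.
  by apply: le_trans (ler_normD _ _) _; rewrite normrZ (gtr0_norm k0) lerD2r.
apply: (@le_lt_trans _ _ (n%:R * (W * W))).
  apply: sum_le_const => i; apply: le_trans (ler_norm _) _.
  by rewrite normrM ler_pM// (le_trans (coord_le_norm _ _ _)).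
have n0 : 0 <= n%:R :> R by exact: ler0n.
rewrite exprMn; apply: (@le_lt_trans _ _ ((n%:R + 1) ^+ 2 * (W * W))).
  by rewrite ler_wpM2r ?mulr_ge0//; nra.
by rewrite ltr_pM2l ?exprn_gt0 ?ltr_wpDl//; nra.
Qed.

Section core.
Variables (Sigma : Type) (S : Sigma -> jet R n) (J0 : jet R n).
Hypotheses (Sigma_inh : inhabited Sigma) (S_neq0 : forall s, S s != 0)
  (S_coef : forall s, NxRnxP (S s)) (S_pointed : pointed_with_axis S J0).

(** By polarity the margin of [approximator_margin] says that the infimum is at
    least [kappa] on the jet of [|x - x0|^2 - C]. *)
Lemma comparison_elliptic (gamma rho c : R) (D Om : set V) x0 :
  0 <= gamma -> directional_cone D -> 0 < rho ->
  (forall s, polar (elliptic_cone gamma D rho) (S s)) ->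
  domain Om -> Om `<=` translated_truncated_cone x0 D rho ->
  comparison (Finf S J0) c Om.
Proof.
move=> g0 [_ Dcone _ _] r0 SM dOm OmD.
have [oOm _ _] := dOm.
have sq x : Om x -> sqdist x0 x < rho ^+ 2 by move=> /OmD[_]; exact: enorm_lt.
have clsq x : closure Om x -> sqdist x0 x <= rho ^+ 2.
  have cl : closed [set y | sqdist x0 y <= rho ^+ 2].
    apply: (@closed_comp _ _ (sqdist x0) [set t | t <= rho ^+ 2]).
      by move=> y _; exact: sqdist_continuous.
    exact: closed_le.
  suff : closure Om `<=` [set y | sqdist x0 y <= rho ^+ 2] by apply.
  by rewrite closureE => y; apply; split => // z Oz; apply: ltW; exact: sq.
have bOm : bounded_set Om.
  exists (`|x0| + rho); split; first exact: num_real.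
  move=> m mr x /sq xr; apply: le_trans (ltW mr).
  rewrite -[x](subrK x0) addrC (le_trans (ler_normD _ _))// lerD2l.
  rewrite -(ler_pXn2r (n := 2))// ?nnegrE// ?(ltW r0)//.
  by apply: le_trans (ltW xr); exact: norm_sqdist.
pose C := rho ^+ 2 + gamma * (2 * rho) + 1.
have gr : 0 <= gamma * (2 * rho) by rewrite !mulr_ge0// ltW.
apply: (comparison_of_approximator Sigma_inh S_neq0 S_coef S_pointed (c := c)
  (psi := fun x => sqdist x0 x - C) dOm bOm _
  (smooth2_addc (- C) (@smooth2_sqdist _ _ x0))).
- move=> x; apply: (@cvgD _ R^o _ (nbhs x)); last exact: cvg_cst.
  exact: sqdist_continuous.
- by move=> x /clsq; rewrite /C; lra.
move=> x Ox.
have [d d0 dO] := near_norm (open_nbhs_nbhs (conj oOm Ox)).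
have dD z : `|z - (x - x0)| < d -> D z.
  move=> zx; have /dO/OmD[] : `|z + x0 - x| < d by rewrite opprB addrA in zx.
  by rewrite addrK.
have [J02 _ _] := S_pointed.
have [k k0 kM] := approximator_margin g0 r0 Dcone (lexx C) d0 dD (sq _ Ox) J02.
exists k => // s; have [_ /(_ _ kM)] := SM s.
rewrite -scaleNr jinnerD jinnerZ mulNr subr_ge0.
move=> /le_trans; apply; rewrite le_eqVlt; apply/orP; left; apply/eqP.
congr (jinner _ (_, _, _)).
  by apply/rowP => i; rewrite !mxE.
by apply/matrixP => i j; rewrite !mxE mulr_natr.
Qed.

End core.
End Cones.


(** * The intersection of half-spaces as a subequation *)

Section Subequation.
Context {R : realType} {n : nat}.
Implicit Types (K J : jet R n) (A F : set (jet R n)).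

Lemma J2D K J : J2 K -> J2 J -> J2 (K + J).
Proof. by rewrite /J2/= => KT JT; rewrite linearD/= KT JT. Qed.

Lemma J2Z (c : R) K : J2 K -> J2 (c *: K).
Proof. by rewrite /J2/= => KT; rewrite linearZ/= KT. Qed.

Lemma jet_nbhs J (P : set (jet R n)) :
  nbhs J P <-> exists2 d : R, 0 < d & forall K, `|K - J| < d -> P K.
Proof.
have H := @nbhs_normP R (R * 'rV[R]_n * 'M[R]_n)%type J P; split.
- by move=> /H[d /= d0 dP]; exists d => // K KJ; apply: dP; rewrite /= distrC.
- by move=> [d d0 dP]; apply/H; exists d => // K /=; rewrite distrC; exact: dP.
Qed.

Lemma jinteriorP F J : J2 J -> jinterior F J <->
  exists2 d : R, 0 < d & forall K, `|K - J| < d -> J2 K -> F K.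
Proof.
move=> J2J; have -> : jinterior F J = within J2 (nbhs J) F.
  by rewrite (nbhs_subspace_in J2J).
exact: jet_nbhs.
Qed.

Lemma jinterior_sub F J : jinterior F J -> F J.
Proof. exact: nbhs_singleton. Qed.

Lemma jclosureP A J : J2 J -> jclosure A J <->
  forall d : R, 0 < d -> exists K, [/\ A K, `|K - J| < d & J2 K].
Proof.
move=> J2J; have E B : nbhs (J : subspace J2) B = within J2 (nbhs J) B.
  by rewrite (nbhs_subspace_in J2J).
split=> [cl d d0|cl B NB].
- have N : nbhs (J : subspace J2) [set K | `|K - J| < d /\ J2 K].
    by rewrite E; apply/jet_nbhs; exists d.
  by have [K [AK [KJ JK]]] := cl _ N; exists K.
- have /jet_nbhs[d d0 dB] : within J2 (nbhs J) B by rewrite -E.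
  by have [K [AK KJ JK]] := cl d d0; exists K; split => //; apply: dB.
Qed.

Lemma jclosure_J2 A J : A `<=` J2 -> jclosure A J -> J2 J.
Proof.
move=> AJ cl; apply/not_notP => nJ.
have N : nbhs (J : subspace J2) [set J].
  have : globally [set J] [set J] by move=> K.
  by rewrite (nbhs_subspace_out nJ).
by have [K [/AJ JK /= KJ]] := cl _ N; apply: nJ; rewrite -KJ.
Qed.

Section core.
Variables (Sigma : Type) (S : Sigma -> jet R n) (J0 : jet R n).
Hypotheses (Sigma_inh : inhabited Sigma) (S_neq0 : forall s, S s != 0)
  (S_coef : forall s, NxRnxP (S s)) (S_pointed : pointed_with_axis S J0).

Let Fset : set (jet R n) := \bigcap_s halfspace S J0 s.
Let G := Finf S J0.
Let J02 : J2 J0. Proof. by case: S_pointed. Qed.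

Let leF := Finf_le Sigma_inh S_neq0 S_coef S_pointed.
Let geF := le_Finf Sigma_inh S_neq0 S_coef S_pointed.
Let axis1 := Fbar_axis S_neq0 S_coef S_pointed.

Lemma FsetP J : Fset J <-> J2 J /\ 0 <= G J.
Proof.
have [s0] := Sigma_inh; split=> [h|[JJ GJ] s _].
  split; first by have [] := h s0 I.
  by apply: geF => s; have [] := h s I.
by split => //; apply: le_trans GJ (leF s J).
Qed.

(** The infimum grows at unit speed along the axis; hence its zero set is the
    boundary, and it is the canonical operator. *)
Lemma Finf_axis J (t : R) : G (J + t *: J0) = G J + t.
Proof.
apply/eqP; rewrite eq_le; apply/andP; split.
  rewrite -lerBlDr; apply: geF => s; rewrite lerBlDr.
  by apply: le_trans (leF s _) _; rewrite FbarD FbarZ axis1 mulr1.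
apply: geF => s; rewrite FbarD FbarZ axis1 mulr1 lerD2r; exact: leF.
Qed.

Lemma Finf_lip : exists2 C : R, 0 <= C & forall K J, G K <= G J + C * `|K - J|.
Proof.
have [C C0 hC] := Fbar_bound S_neq0 S_coef S_pointed; exists C => // K J.
rewrite -lerBlDr; apply: geF => s; rewrite lerBlDr.
apply: le_trans (leF s K) _; rewrite -{1}[K](subrK J) FbarD addrC lerD2l.
by apply: le_trans (hC s _); rewrite ler_norm.
Qed.

Lemma jinterior_Fset J : J2 J -> jinterior Fset J <-> 0 < G J.
Proof.
move=> JJ; have [C C0 hC] := Finf_lip.
split=> [|GJ].
- move=> /(jinteriorP _ JJ)[d d0 dF]; pose t := d / (2 * (`|J0| + 1)).
  have N1 : 0 < `|J0| + 1 by rewrite ltr_wpDl.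
  have t0 : 0 < t by rewrite divr_gt0// mulr_gt0.
  have /FsetP[_] : Fset (J + (- t) *: J0).
    apply: dF; last by apply: J2D => //; apply: J2Z.
    rewrite addrC addKr normrZ normrN (gtr0_norm t0).
    apply: (@le_lt_trans _ _ (t * (`|J0| + 1))).
      by rewrite ler_wpM2l ?(ltW t0)// lerDl.
    have -> : t * (`|J0| + 1) = d / 2 by rewrite /t; field; rewrite gt_eqF.
    lra.
  by rewrite Finf_axis; lra.
- apply/(jinteriorP _ JJ); have C1 : 0 < C + 1 by rewrite ltr_wpDl.
  exists (G J / (C + 1)); first by rewrite divr_gt0.
  move=> K KJ JK; apply/FsetP; split=> //.
  have := hC J K; rewrite distrC => h; rewrite ltr_pdivlMr// in KJ.
  by have := normr_ge0 (K - J); lra.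
Qed.

Lemma jclosure_sub_Fset A : A `<=` Fset -> jclosure A `<=` Fset.
Proof.
move=> AF J cl.
have AJ : A `<=` J2 by move=> K /AF/FsetP[].
have JJ := jclosure_J2 AJ cl; apply/FsetP; split => //.
have [C C0 hC] := Finf_lip; have C1 : 0 < C + 1 by rewrite ltr_wpDl.
rewrite leNgt; apply/negP => GJ.
have [|K [/AF/FsetP[_ GK] KJ _]] := (jclosureP A JJ).1 cl (- G J / (C + 1)).
  by rewrite divr_gt0// oppr_gt0.
have := hC K J; rewrite ltr_pdivlMr// in KJ.
by have := normr_ge0 (K - J); lra.
Qed.

Lemma Fset_closure_interior : Fset = jclosure (jinterior Fset).
Proof.
apply/seteqP; split => [J FJ|]; last first.
  by apply: jclosure_sub_Fset => J /jinterior_sub.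
have [JJ GJ] := (FsetP J).1 FJ.
apply/(jclosureP _ JJ) => d d0; pose t := d / (2 * (`|J0| + 1)).
have N1 : 0 < `|J0| + 1 by rewrite ltr_wpDl.
have t0 : 0 < t by rewrite divr_gt0// mulr_gt0.
have JK : J2 (J + t *: J0) by apply: J2D => //; apply: J2Z.
exists (J + t *: J0); split => //.
  by apply/(jinterior_Fset JK); rewrite Finf_axis; lra.
rewrite addrC addKr normrZ (gtr0_norm t0).
apply: (@le_lt_trans _ _ (t * (`|J0| + 1))).
  by rewrite ler_wpM2l ?(ltW t0)// lerDl.
have -> : t * (`|J0| + 1) = d / 2 by rewrite /t; field; rewrite gt_eqF.
lra.
Qed.

Let Gaxis : 1 <= G J0.
Proof. by apply: geF => s; rewrite axis1. Qed.

Lemma subequation_bigcap : subequation Fset.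
Proof.
split; split.
- by move=> J /FsetP[].
- by exists J0; apply/FsetP; split=> //; exact: le_trans ler01 Gaxis.
- move=> E; have : Fset ((-2) *: J0) by rewrite E; apply: J2Z.
  move=> /FsetP[_]; have [s] := Sigma_inh.
  move=> /le_trans/(_ (leF s _)); rewrite FbarZ axis1 => h; clear E; lra.
- move=> r p A Q FJ Qp s _; have [JJ h] := FJ s I; have [_ Sp] := S_coef s.
  have E : (r, p, A + Q) = (r, p, A) + (0, 0, Q) :> jet R n.
    by congr (_, _, _); rewrite /= addr0.
  rewrite E; split; first by apply: J2D => //; case: Qp.
  rewrite FbarD addr_ge0//; apply: divr_ge0.
    rewrite /jinner/= mulr0 add0r /dot big1; last by move=> i _; rewrite mxE mulr0.
    by rewrite add0r trace_psd_ge0.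
  by rewrite ltW// axis_gt0.
- move=> r t p A FJ t0 s _; have [JJ h] := FJ s I; have [a0 _] := S_coef s.
  have E : (r + t, p, A) = (r, p, A) + (t, 0, 0) :> jet R n.
    by congr (_, _, _); rewrite /= addr0.
  rewrite E; split; first by apply: J2D => //; rewrite /J2/= trmx0.
  rewrite FbarD addr_ge0//; apply: divr_ge0.
    rewrite /jinner/= mulmx0 mxtrace0 addr0 /dot big1 ?addr0; last first.
      by move=> i _; rewrite mxE mulr0.
    by rewrite mulr_le0.
  by rewrite ltW// axis_gt0.
- exact: Fset_closure_interior.
Qed.

Lemma convex_cone_bigcap : convex_cone_subequation Fset.
Proof.
split; first exact: subequation_bigcap.
- move=> t J t0 FJ s _; have [JJ h] := FJ s I; split; first exact: J2Z.
  by rewrite FbarZ mulr_ge0.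
- move=> K J l; rewrite !inE => FK FJ s _.
  have [KK hK] := FK s I; have [JJ hJ] := FJ s I.
  rewrite -[conv l K J]/(l%:num *: (K : jet R n) + (1 - l%:num) *: (J : jet R n)).
  split; first by apply: J2D; apply: J2Z.
  rewrite FbarD !FbarZ addr_ge0// mulr_ge0// subr_ge0.
Qed.

Lemma canonical_operator_bigcap : canonical_operator Fset J0 G.
Proof.
split; first by apply/(jinterior_Fset J02); exact: lt_le_trans ltr01 Gaxis.
move=> J JJ t; have JK : J2 (J + t *: J0) by apply: J2D => //; apply: J2Z.
have FcF : jclosure Fset `<=` Fset by apply: jclosure_sub_Fset.
split=> [[/FcF/FsetP[_]]|tE].
  rewrite Finf_axis => h1 h2.
  have : ~ 0 < G J + t.
    by move=> h3; apply: h2; apply/(jinterior_Fset JK); rewrite Finf_axis.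
  by move/negP; rewrite -leNgt; lra.
have GK : G (J + t *: J0) = 0 by rewrite Finf_axis tE subrr.
split; first by apply: subset_closure; apply/FsetP; rewrite GK.
by move=> /(jinterior_Fset JK); rewrite GK ltxx.
Qed.

End core.

(** A half-space is the intersection of a family with a single member. *)
Lemma subequation_halfspace (Sigma : Type) (S : Sigma -> jet R n) J0 s :
  (forall s, S s != 0) -> (forall s, NxRnxP (S s)) -> pointed_with_axis S J0 ->
  subequation (halfspace S J0 s).
Proof.
move=> S0 Sc [J02 J00 [eps e0 he]].
have -> : halfspace S J0 s = \bigcap_(i in [set: unit]) halfspace (fun=> S s) J0 i.
  by apply/seteqP; split=> [J h i _|J /(_ tt I)].
apply: subequation_bigcap => //.
by split => //; exists eps.
Qed.

End Subequation.

Unset Implicit Arguments.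

Theorem theorem12p26 (R : realType) (n : nat) (n_gt0 : (0 < n)%N)
    (Sigma : Type) (Sigma_inh : inhabited Sigma)
    (S : Sigma -> jet R n) (J0 : jet R n)
    (S_neq0 : forall s, S s != 0)
    (S_coef : forall s, NxRnxP (S s))
    (S_pointed : pointed_with_axis S J0) :
  [/\ (forall s, subequation (halfspace S J0 s)),
      convex_cone_subequation (\bigcap_s halfspace S J0 s)
    & canonical_operator (\bigcap_s halfspace S J0 s) J0 (Finf S J0)]
  /\
  (forall M : set (jet R n), cone_bounded M -> (forall s, polar M (S s)) ->
     forall (c : R) (Om : set 'rV[R]_n), domain Om -> bounded_set Om ->
       comparison (Finf S J0) c Om)
  /\
  (forall (M : set (jet R n)) (D : set 'rV[R]_n) (rho : R),
     cone_radius M D rho -> (forall s, polar M (S s)) ->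
     forall (c : R) (Om : set 'rV[R]_n) (x0 : 'rV[R]_n),
       domain Om -> Om `<=` translated_truncated_cone x0 D rho ->
       comparison (Finf S J0) c Om).
Proof.
split; [split|split].
- by move=> s; exact: subequation_halfspace.
- exact: convex_cone_bigcap.
- exact: canonical_operator_bigcap.
- move=> M /cone_bounded_elliptic[gamma [D [gamma0 dirD DM]]] SM c Om dOm bOm.
  have [x0 [rho [rho0 OmD]]] := bounded_in_truncated_cone dirD bOm.
  apply: (comparison_elliptic Sigma_inh S_neq0 S_coef S_pointed
    gamma0 dirD rho0 _ dOm OmD) => s.
  exact: polar_anti (DM _ rho0) _ (SM s).
- move=> M D rho /cone_radius_elliptic[dirD rho0 [gamma gamma0 DM]] SM.
  move=> c Om x0 dOm OmD.
  apply: (comparison_elliptic Sigma_inh S_neq0 S_coef S_pointed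
    gamma0 dirD rho0 _ dOm OmD) => s.
  exact: polar_anti DM _ (SM s).
Qed.
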